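(* Let $\omega\in[0,1]$ and let $A\in\mathbb{C}^{m\times m}$, $B\in\mathbb{C}^{m\times n}$, $C\in\mathbb{C}^{n\times m}$, $D\in\mathbb{C}^{n\times n}$ be such that $XCX-XD-AX+B=0$ is in class $\mathbb{H}^\omega$, and suppose that $Q_\omega\mathbf{1}>0$, where $Q=\begin{pmatrix}D&-C\\-B&A\end{pmatrix}$. Let $\Phi$ and $\Psi$ be the extremal solutions of $XCX-XD-AX+B=0$ and of its dual $YBY-YA-DY+C=0$, respectively. Apply ADDA to $XCX-XD-AX+B=0$ with $\alpha=tz_\omega^\bot$ and $\beta=\gamma z_\omega^\bot$, where $z_\omega^\bot=\omega+\mathrm{j}(1-\omega)$, and assume $\gamma=ct$ with $c>0$. If $t>\max\{\eta_{\omega,1}(c),\eta_{\omega,2}(c)\}$, where $$\eta_{\omega,1}(c)=\max_{i=1,\dots,n}r_{\omega,i}(c),\qquad \eta_{\omega,2}(c)=\max_{i=n+1,\dots,m+n}r_{\omega,i}(c),$$ $$r_{\omega,i}(c)=\frac{-(c-1)p_{\omega,i}+\sqrt{(c-1)^2p_{\omega,i}^2+4c(p_{\omega,i}^2-s_{\omega,i}^2)}}{2c\varpi},\quad i=1,\dots,n,$$ $$r_{\omega,i}(c)=\frac{(c-1)p_{\omega,i}+\sqrt{(c-1)^2p_{\omega,i}^2+4c(p_{\omega,i}^2-s_{\omega,i}^2)}}{2c\varpi},\quad i=n+1,\dots,m+n,$$ then the sequences $\{E_k\},\{F_k\},\{H_k\},\{G_k\}$ are well-defined and $\{H_k\}$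 and $\{G_k\}$ converge quadratically to $\Phi$ and $\Psi$, respectively.
   Context: For a complex square matrix $M$ and a real $\omega\in[0,1]$, the $\omega$-comparison matrix $M_\omega$ is the real matrix with entries $[M_\omega]_{ii}=\omega\,\mathrm{Re}([M]_{ii})+(1-\omega)\,\mathrm{Im}([M]_{ii})$ and $[M_\omega]_{ij}=-|[M]_{ij}|$ for $i\ne j$. A real square matrix $M$ is a nonsingular M-matrix if all its off-diagonal entries are nonpositive and $Mu>0$ (entrywise) for some vector $u>0$. $\mathbf{1}$ is the all-ones column vector; $\mathrm{j}$ is the imaginary unit. The equation is in class $\mathbb{H}^\omega$ if $Q_\omega$ is a nonsingular M-matrix. Notation: $\varpi=\omega^2+(1-\omega)^2$, $q_i=\sum_{j\ne i}|[Q]_{ij}|$, and for $i=1,\dots,m+n$ $$p_{\omega,i}=\frac{\omega\mathrm{Re}([Q]_{ii})+(1-\omega)\mathrm{Im}([Q]_{ii})+q_i}{2}+\frac{(\omega\mathrm{Im}([Q]_{ii})-(1-\omega)\mathrm{Re}([Q]_{ii}))^2}{2(\omega\mathrm{Re}([Q]_{ii})+(1-\omega)\mathrm{Im}([Q]_{ii})-q_i)},$$ $$s_{\omega,i}=\frac{\omega\mathrm{Re}([Q]_{ii})+(1-\omega)\mathrm{Im}([Q]_{ii})-q_i}{2}+\frac{(\omega\mathrm{Im}([Q]_{ii})-(1-\omega)\mathrm{Re}([Q]_{ii}))^2}{2(\omega\mathrm{Re}([Q]_{ii})+(1-\omega)\mathrm{Im}([Q]_{ii})-q_i)}.$$ Extremal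 solutions: $\Phi$ is the unique solution of $XCX-XD-AX+B=0$ such that every eigenvalue $\lambda$ of $D-C\Phi$ satisfies $\omega\,\mathrm{Re}(\lambda)+(1-\omega)\,\mathrm{Im}(\lambda)>0$; $\Psi$ is the unique solution of $YBY-YA-DY+C=0$ such that every eigenvalue $\lambda$ of $A-B\Psi$ satisfies the same inequality (both exist and are unique under these hypotheses). ADDA with parameters $\alpha,\beta$: put $A_\beta=A+\beta I$, $D_\alpha=D+\alpha I$, $W_{\alpha\beta}=A_\beta-BD_\alpha^{-1}C$, $V_{\alpha\beta}=D_\alpha-CA_\beta^{-1}B$, and $$E_0=I-(\alpha+\beta)V_{\alpha\beta}^{-1},\ F_0=I-(\alpha+\beta)W_{\alpha\beta}^{-1},\ G_0=(\alpha+\beta)D_\alpha^{-1}CW_{\alpha\beta}^{-1},\ H_0=(\alpha+\beta)W_{\alpha\beta}^{-1}BD_\alpha^{-1};$$ for $k\ge0$, $$E_{k+1}=E_k(I-G_kH_k)^{-1}E_k,\quad F_{k+1}=F_k(I-H_kG_k)^{-1}F_k,$$ $$G_{k+1}=G_k+E_k(I-G_kH_k)^{-1}G_kF_k,\quad H_{k+1}=H_k+F_k(I-H_kG_k)^{-1}H_kE_k.$$ ''Well-defined'' means all inverses involved exist. Quadratic convergence of the doubling algorithm means $\limsup_{k\to\infty}\|H_k-\Phi\|^{1/2^k}<1$ and $\limsup_{k\to\infty}\|G_k-\Psi\|^{1/2^k}<1$. *)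

(* Defs.v *)
From HB Require Import structures.
From mathcomp Require Import all_boot all_order all_algebra.
From mathcomp Require Import all_classical all_reals all_analysis.
From mathcomp Require Import complex.

Set Implicit Arguments.
Unset Strict Implicit.
Unset Printing Implicit Defensive.

Import Order.TTheory GRing.Theory Num.Theory.

Local Open Scope ring_scope.
Local Open Scope complex_scope.

Section Comparison.
Context {R : realType}.
Implicit Types (w : R) (z : R[i]).

Definition cabs z : R := complex.Re `|z|.

Definition omega_re w z : R := w * complex.Re z + (1 - w) * complex.Im z.
Definition omega_im w z : R := w * complex.Im z - (1 - w) * complex.Re z.

Definition comparison_mx w (N : nat) (M : 'M[R[i]]_N) : 'M[R]_N :=
  \matrix_(i, j) if i == j then omega_re w (M i i) else - cabs (M i j).

Definition mx_pos (p q : nat) (M : 'M[R]_(p, q)) : Prop :=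
  forall i j, 0 < M i j.

Definition nonsingular_M_matrix (N : nat) (M : 'M[R]_N) : Prop :=
  (forall i j, i != j -> M i j <= 0) /\
  (exists u : 'cV[R]_N, mx_pos u /\ mx_pos (M *m u)).

Definition offdiag_sum (N : nat) (Q : 'M[R[i]]_N) (i : 'I_N) : R :=
  \sum_(j | j != i) cabs (Q i j).

Definition p_ w (N : nat) (Q : 'M[R[i]]_N) (i : 'I_N) : R :=
  (omega_re w (Q i i) + offdiag_sum Q i) / 2 +
  omega_im w (Q i i) ^+ 2 / (2 * (omega_re w (Q i i) - offdiag_sum Q i)).

Definition s_ w (N : nat) (Q : 'M[R[i]]_N) (i : 'I_N) : R :=
  (omega_re w (Q i i) - offdiag_sum Q i) / 2 +
  omega_im w (Q i i) ^+ 2 / (2 * (omega_re w (Q i i) - offdiag_sum Q i)).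

Definition varpi w : R := w ^+ 2 + (1 - w) ^+ 2.

Definition r_discr w (N : nat) (Q : 'M[R[i]]_N) (c : R) (i : 'I_N) : R :=
  (c - 1) ^+ 2 * p_ w Q i ^+ 2 + 4 * c * (p_ w Q i ^+ 2 - s_ w Q i ^+ 2).

(* The sign of the linear term depends on whether the row [i] belongs to the
   first ([D]) or to the second ([A]) diagonal block of [Q]. *)
Definition r_ w (n m : nat) (Q : 'M[R[i]]_(n + m)) (c : R)
    (i : 'I_(n + m)) : R :=
  match fintype.split i with
  | inl _ => (- (c - 1) * p_ w Q i + Num.sqrt (r_discr w Q c i))
             / (2 * c * varpi w)
  | inr _ => ((c - 1) * p_ w Q i + Num.sqrt (r_discr w Q c i))
             / (2 * c * varpi w)
  end.

(* The blocks have positive sizes [n.+1] and [m.+1], so that the maxima are over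
   nonempty ranges; the default value of each big operator is itself one of the
   terms. *)
Definition eta1 w (n m : nat) (Q : 'M[R[i]]_(n.+1 + m.+1)) (c : R) : R :=
  \big[Order.max/r_ w Q c (lshift m.+1 ord0)]_(i < n.+1)
    r_ w Q c (lshift m.+1 i).

Definition eta2 w (n m : nat) (Q : 'M[R[i]]_(n.+1 + m.+1)) (c : R) : R :=
  \big[Order.max/r_ w Q c (rshift n.+1 ord0)]_(i < m.+1)
    r_ w Q c (rshift n.+1 i).

Definition z_bot w : R[i] := w +i* (1 - w).

End Comparison.

Section Riccati.
Context {R : realType} {m n : nat}.
Variables (A : 'M[R[i]]_m) (B : 'M[R[i]]_(m, n)).
Variables (C : 'M[R[i]]_(n, m)) (D : 'M[R[i]]_n).

Definition coef_mx : 'M[R[i]]_(n + m) := block_mx D (- C) (- B) A.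

Definition class_H (w : R) : Prop :=
  nonsingular_M_matrix (comparison_mx w coef_mx).

Definition riccati_sol (X : 'M[R[i]]_(m, n)) : Prop :=
  X *m C *m X - X *m D - A *m X + B = 0.

(* [class_H w] guarantees that there is exactly one such solution. *)
Definition extremal_sol (w : R) (X : 'M[R[i]]_(m, n)) : Prop :=
  riccati_sol X /\
  (forall l : R[i], eigenvalue (D - C *m X) l -> 0 < omega_re w l).

End Riccati.

Section ADDA.
Context {R : realType} {m n : nat}.

Record adda_state := AddaState {
  Ek : 'M[R[i]]_n;
  Fk : 'M[R[i]]_m;
  Gk : 'M[R[i]]_(n, m);
  Hk : 'M[R[i]]_(m, n) }.

Definition adda_step (x : adda_state) : adda_state :=
  let: AddaState E F G H := x in
  let IGH := invmx (1%:M - G *m H) in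
  let IHG := invmx (1%:M - H *m G) in
  AddaState (E *m IGH *m E)
            (F *m IHG *m F)
            (G + E *m IGH *m G *m F)
            (H + F *m IHG *m H *m E).

Variables (A : 'M[R[i]]_m) (B : 'M[R[i]]_(m, n)).
Variables (C : 'M[R[i]]_(n, m)) (D : 'M[R[i]]_n).
Variables (alpha beta : R[i]).

Definition A_shift : 'M[R[i]]_m := A + beta%:M.
Definition D_shift : 'M[R[i]]_n := D + alpha%:M.
Definition W_mx : 'M[R[i]]_m := A_shift - B *m invmx D_shift *m C.
Definition V_mx : 'M[R[i]]_n := D_shift - C *m invmx A_shift *m B.

Definition adda_init : adda_state :=
  AddaState
    (1%:M - (alpha + beta) *: invmx V_mx)
    (1%:M - (alpha + beta) *: invmx W_mx)
    ((alpha + beta) *: (invmx D_shift *m C *m invmx W_mx))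
    ((alpha + beta) *: (invmx W_mx *m B *m invmx D_shift)).

Definition adda (k : nat) : adda_state := iter k adda_step adda_init.

(* [invmx] is total (the identity outside [unitmx]); the sequences are
   meaningful only when every matrix that gets inverted is a unit. *)
Definition adda_well_defined : Prop :=
  [/\ A_shift \in unitmx, D_shift \in unitmx, W_mx \in unitmx,
      V_mx \in unitmx &
      forall k, 1%:M - Gk (adda k) *m Hk (adda k) \in unitmx /\
                1%:M - Hk (adda k) *m Gk (adda k) \in unitmx].

End ADDA.

Section QuadraticConvergence.
Context {R : realType} {p q : nat}.

Definition is_norm (nu : 'M[R[i]]_(p, q) -> R) : Prop :=
  [/\ forall X Y, nu (X + Y) <= nu X + nu Y,
      forall (a : R[i]) X, nu (a *: X) = cabs a * nu X &
      forall X, nu X = 0 -> X = 0].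

(* No particular norm is singled out: the bound is required for all of them. *)
Definition quadratic_cvg (u : nat -> 'M[R[i]]_(p, q)) (L : 'M[R[i]]_(p, q)) :
    Prop :=
  forall nu, is_norm nu ->
    (limn_esup (fun k => (nu (u k - L) `^ (1 / 2 ^+ k))%:E) < 1%:E)%E.

End QuadraticConvergence.

(* Main.v *)
Require Import Defs.
From mathcomp Require Import all_boot all_order all_algebra.
From mathcomp Require Import all_classical all_reals all_analysis.
From mathcomp Require Import complex ring lra.

(** Let [Q] be the coefficient matrix and [M] the matrix with blocks [E0],
    [-G0], [-H0], [F0].  Then
      [M = (Q + diag(alpha, beta))^-1 (Q - diag(beta, alpha))],
    so that sizes of [M] are governed by the rows of [Q].  Multiplying by the
    conjugate of [z_bot] turns the shifts into real ones, and the bound on [t]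
    then gives, for each diagonal entry [d] with off-diagonal row sum [q],
      [(1 + c) q + |d - beta| < c |d + alpha|]    on the rows of [D],
      [(1 + c) q + c |d - alpha| < |d + beta|]    on the rows of [A]
    ([row_gap]).  By diagonal dominance [M] is a strict contraction, with some
    ratio [k < 1], for sup norms in which the two blocks are measured in units
    [1, c] on input and [c, 1] on output ([contractive_init]).

    A doubling step is a feedback interconnection of two copies of the state.
    Such an interconnection keeps the ratio [k] and squares the unit [c]
    ([contractive_step]).  Hence [G_j] and [H_j] have norm at most [k], which
    makes [I - G_j H_j] and [I - H_j G_j] invertible at every step.

    For convergence put [L = D - C Phi] and [T = (L + alpha)^-1 (L - beta)].
    The Riccati equation gives [T = E0 + G0 Phi T] and [Phi = H0 + F0 Phi T],
    and doubling turns these into the same relations for the [j]-th state and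
    [T^(2^j)] ([intertwines_step]); in particular
      [Phi - H_j = F_j Phi T^(2^j)].
    Here [F_j] has norm at most [k c^-(2^j)], so it is enough that [Phi] has
    norm at most [1] and [T] norm at most [k c].  Both follow from the initial
    contraction as soon as the powers of [T / c] are bounded
    ([solution_contraction]).  They are, because an eigenvalue of [L] in the
    prescribed half plane lies in a Gershgorin disc of a row of [D], where the
    first inequality above forces the corresponding eigenvalue of [T] to have
    modulus less than [c] ([closed_loop_spectrum], [cayley_spectrum]).  The
    error is then at most [k^(2^j)].

    The claims about [G_j] and [Psi] are those about [H_j] and [Phi] for the
    equation with [A, D], [B, C] and [alpha, beta] exchanged, [c] being
    replaced by [1 / c] ([adda_swap], [shift_dominant_swap]). *)

Set Implicit Arguments.
Unset Strict Implicit.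
Unset Printing Implicit Defensive.

Import Order.TTheory GRing.Theory Num.Theory.

Local Open Scope ring_scope.
Local Open Scope complex_scope.

(** * Moduli of complex numbers and the rotated coordinates *)

Section Modulus.
Context {R : realType}.
Implicit Types (x y z : R[i]) (w : R).

Lemma cabsE z : cabs z = Num.sqrt (complex.Re z ^+ 2 + complex.Im z ^+ 2).
Proof. by rewrite /cabs normc_def. Qed.

Lemma normr_cabs z : `|z| = (cabs z)%:C.
Proof. by rewrite cabsE normc_def. Qed.

Lemma cabs_ge0 z : 0 <= cabs z.
Proof. by rewrite cabsE sqrtr_ge0. Qed.

Lemma cabsM x y : cabs (x * y) = cabs x * cabs y :> R.
Proof. by apply: complexI; rewrite rmorphM -!normr_cabs normrM. Qed.

Lemma cabsD x y : cabs (x + y) <= cabs x + cabs y.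
Proof. by rewrite -lecR rmorphD -!normr_cabs ler_normD. Qed.

Lemma cabsN z : cabs (- z) = cabs z.
Proof. by rewrite /cabs normrN. Qed.

Lemma cabsB x y : cabs (x - y) <= cabs x + cabs y.
Proof. by rewrite -(cabsN y) cabsD. Qed.

Lemma cabs0 : cabs (0 : R[i]) = 0.
Proof. by rewrite /cabs normr0. Qed.

Lemma cabs_eq0 z : cabs z = 0 -> z = 0.
Proof. by move=> z0; apply/normr0_eq0; rewrite normr_cabs z0. Qed.

Lemma cabs_gt0 z : (0 < cabs z) = (z != 0).
Proof.
rewrite lt_neqAle cabs_ge0 andbT eq_sym; congr (~~ _).
by apply/eqP/eqP => [/cabs_eq0|->]; rewrite ?cabs0.
Qed.

Lemma cabs_real w : cabs w%:C = `|w|.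
Proof. by rewrite cabsE /= expr0n addr0 sqrtr_sqr. Qed.

Lemma cabs_sum (I : finType) (P : pred I) (F : I -> R[i]) :
  cabs (\sum_(i | P i) F i) <= \sum_(i | P i) cabs (F i).
Proof.
elim/big_ind2: _ => [|x1 y1 x2 y2 h1 h2|//]; first by rewrite cabs0.
exact: le_trans (cabsD _ _) (lerD h1 h2).
Qed.

Lemma cabs_z_bot w : 0 <= w <= 1 -> 0 < cabs (z_bot w) <= 1.
Proof.
move=> /andP[w0 w1]; rewrite cabsE /=; apply/andP; split.
  by rewrite sqrtr_gt0; nra.
by rewrite -[leRHS]sqrtr1 ler_sqrt //; nra.
Qed.

Lemma cabs_z_bot_sqr w : cabs (z_bot w) ^+ 2 = varpi w.
Proof. by rewrite cabsE sqr_sqrtr ?addr_ge0 ?sqr_ge0. Qed.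

(** The number [omega_re w z + i omega_im w z] is the product of [z] and the
    conjugate of [z_bot w]. *)
Lemma omega_coord w z :
  cabs (z_bot w) * cabs z = Num.sqrt (omega_re w z ^+ 2 + omega_im w z ^+ 2).
Proof.
rewrite !cabsE -sqrtrM ?addr_ge0 ?sqr_ge0 //; congr Num.sqrt.
by rewrite /omega_re /omega_im /=; ring.
Qed.

Lemma omega_re_le_cabs w z : 0 <= w <= 1 -> omega_re w z <= cabs z.
Proof.
move=> /cabs_z_bot /andP[z0 z1].
apply: le_trans (_ : cabs (z_bot w) * cabs z <= _); last first.
  by rewrite ler_piMl ?cabs_ge0.
rewrite omega_coord; apply: le_trans (ler_norm _) _.
by rewrite -sqrtr_sqr ler_sqrt ?addr_ge0 ?sqr_ge0 // lerDl sqr_ge0.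
Qed.

Lemma omega_reD w x y : omega_re w (x + y) = omega_re w x + omega_re w y :> R.
Proof. by case: x y => [a b] [a' b']; rewrite /omega_re /=; ring. Qed.

Lemma omega_imD w x y : omega_im w (x + y) = omega_im w x + omega_im w y :> R.
Proof. by case: x y => [a b] [a' b']; rewrite /omega_im /=; ring. Qed.

Lemma omega_re_z_bot w (t : R) : omega_re w (t%:C * z_bot w) = t * varpi w.
Proof. by rewrite /omega_re /varpi /=; ring. Qed.

Lemma omega_im_z_bot w (t : R) : omega_im w (t%:C * z_bot w) = 0.
Proof. by rewrite /omega_im /=; ring. Qed.

End Modulus.

(** * From the bound on the parameters to inequalities on the rows *)

Section ParameterCondition.
Context {R : realType}.
Implicit Types (w a b q c t : R).

(** Geometrically, [a + i b] lies on the circle with centre [p] and radius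
    [p - q], and the claim puts it inside a Cartesian oval with foci [-t] and
    [c t].  With [K = p (c - 1) + c t], squaring twice and eliminating
    [b ^+ 2] through [p] reduces the claim to
    [0 < (a - q) K ^+ 2 + 2 q c (t K - p q)], while the hypothesis reads
    [q (2 p - q) < t K] and [q <= p]. *)
Lemma shift_gap a b q c t :
  let p := (a + q) / 2 + b ^+ 2 / (2 * (a - q)) in
  0 <= q -> q < a -> 0 < c -> 0 < t ->
  p ^+ 2 - (p - q) ^+ 2 < c * t ^+ 2 + (c - 1) * p * t ->
  (1 + c) * q + Num.sqrt ((a - c * t) ^+ 2 + b ^+ 2)
    < c * Num.sqrt ((a + t) ^+ 2 + b ^+ 2).
Proof.
move=> p q0 qa c0 t0 hyp.
have e0 : 0 < a - q by rewrite subr_gt0.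
have bE : b ^+ 2 = 2 * (a - q) * p - a ^+ 2 + q ^+ 2.
  by rewrite /p; field; rewrite gt_eqF.
have qp : q <= p.
  rewrite /p -lerBlDl; apply: le_trans (_ : 0 <= _); first lra.
  by rewrite divr_ge0 ?sqr_ge0 //; lra.
move: (p) bE qp hyp => {}p bE qp hyp.
pose K := p * (c - 1) + c * t; pose L := c * t - q.
have tK : q * (2 * p - q) < t * K by rewrite /K; lra.
have K0 : 0 < K.
  by rewrite -(pmulr_rgt0 _ t0); apply: le_lt_trans tK; nra.
have KL : q * (p - c * t) < K * L.
  have -> : K * L = q * (p - c * t) + c * (t * K - p * q) by rewrite /K /L; ring.
  by rewrite ltrDl mulr_gt0 // subr_gt0; apply: le_lt_trans tK; nra.
(* Otherwise [c t < q <= p] and [K L < 0 < q (p - c t)]. *)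
have L0 : 0 <= L.
  by rewrite leNgt; apply/negP => L0; rewrite /L in L0 KL; nra.
pose v := Num.sqrt ((a - c * t) ^+ 2 + b ^+ 2).
have v0 : 0 <= v by exact: sqrtr_ge0.
have vE : v ^+ 2 = (a - c * t) ^+ 2 + b ^+ 2.
  by rewrite sqr_sqrtr ?addr_ge0 ?sqr_ge0.
have vE' : v ^+ 2 = 2 * (p - c * t) * (a - q) + L ^+ 2.
  by rewrite vE bE /L; ring.
have qv : q * v < (a - q) * K + q * L.
  have rhs0 : 0 < (a - q) * K + q * L by rewrite ltr_wpDr ?mulr_gt0 ?mulr_ge0.
  rewrite -(@ltr_pXn2r _ 2) ?nnegrE ?mulr_ge0 ?(ltW rhs0) //.
  rewrite exprMn vE' -subr_gt0.
  have -> : ((a - q) * K + q * L) ^+ 2 -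
      q ^+ 2 * (2 * (p - c * t) * (a - q) + L ^+ 2) =
      (a - q) * ((a - q) * K ^+ 2 + 2 * q * (K * L - q * (p - c * t))) by ring.
  apply: mulr_gt0 => //; rewrite ltr_wpDr ?mulr_gt0 ?exprn_gt0 //.
  by rewrite mulr_ge0 ?mulr_ge0 ?subr_ge0 ?(ltW KL) //; lra.
have -> : c * Num.sqrt ((a + t) ^+ 2 + b ^+ 2) =
    Num.sqrt (c ^+ 2 * ((a + t) ^+ 2 + b ^+ 2)).
  by rewrite sqrtrM ?sqr_ge0 // sqrtr_sqr ger0_norm // ltW.
rewrite -/v.
have lhs0 : 0 <= (1 + c) * q + v by apply: addr_ge0 => //; nra.
rewrite -[ltLHS](ger0_norm lhs0) -sqrtr_sqr ltr_sqrt; last first.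
  have : 0 < (a + t) ^+ 2 by rewrite exprn_gt0; lra.
  by move=> h; rewrite mulr_gt0 ?exprn_gt0 // ltr_wpDr ?sqr_ge0.
rewrite -subr_gt0 (sqrrD ((1 + c) * q)) vE bE.
have -> : c ^+ 2 * ((a + t) ^+ 2 + (2 * (a - q) * p - a ^+ 2 + q ^+ 2)) -
   (((1 + c) * q) ^+ 2 + (1 + c) * q * v *+ 2 +
     ((a - c * t) ^+ 2 + (2 * (a - q) * p - a ^+ 2 + q ^+ 2))) =
   2 * (1 + c) * ((a - q) * K + q * L - q * v) by rewrite /K /L; ring.
by rewrite mulr_gt0 ?subr_gt0 //; lra.
Qed.

(** The other root is nonpositive since the product of the roots is [- D / c],
    so being above the larger root already makes the quadratic positive. *)
Lemma quadratic_root_gt c p D u :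
  0 < c -> 0 <= D ->
  (- (c - 1) * p + Num.sqrt ((c - 1) ^+ 2 * p ^+ 2 + 4 * c * D)) / (2 * c) < u ->
  0 < u /\ D < c * u ^+ 2 + (c - 1) * p * u.
Proof.
move=> c0 D0; set S := Num.sqrt _.
have cD0 : 0 <= 4 * c * D by rewrite mulr_ge0 //; lra.
have S0 : 0 <= S by exact: sqrtr_ge0.
have SE : S ^+ 2 = (c - 1) ^+ 2 * p ^+ 2 + 4 * c * D.
  by rewrite sqr_sqrtr // addr_ge0 // mulr_ge0 ?sqr_ge0.
have Sge : `|(c - 1) * p| <= S.
  by rewrite -sqrtr_sqr ler_wsqrtr // exprMn lerDl.
have [Sl Sr] : - S <= (c - 1) * p /\ (c - 1) * p <= S.
  by move: Sge; rewrite ler_norml => /andP[].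
rewrite ltr_pdivrMr; last lra.
move=> hu.
have u0 : 0 < u by nra.
split=> //.
have : 0 < (2 * c * u + (c - 1) * p - S) * (2 * c * u + (c - 1) * p + S).
  by rewrite mulr_gt0 //; nra.
have -> : (2 * c * u + (c - 1) * p - S) * (2 * c * u + (c - 1) * p + S) =
  4 * c * (c * u ^+ 2 + (c - 1) * p * u - D).
  by transitivity ((2 * c * u + (c - 1) * p) ^+ 2 - S ^+ 2); [ring|rewrite SE; ring].
by rewrite pmulr_rgt0 ?subr_gt0 //; lra.
Qed.

(** Passing to the rotated coordinates multiplies every modulus by
    [cabs (z_bot w)], which is at most [1]: the off-diagonal term [q], not
    rotated, only makes the rotated inequality stronger. *)
Lemma row_gap w c t q (d : R[i]) :
  let a := omega_re w d in
  let p := (a + q) / 2 + omega_im w d ^+ 2 / (2 * (a - q)) in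
  let s := (a - q) / 2 + omega_im w d ^+ 2 / (2 * (a - q)) in
  0 <= w <= 1 -> 0 <= q -> q < a -> 0 < c ->
  (- (c - 1) * p +
     Num.sqrt ((c - 1) ^+ 2 * p ^+ 2 + 4 * c * (p ^+ 2 - s ^+ 2)))
    / (2 * c * varpi w) < t ->
  0 < t /\
  (1 + c) * q + cabs (d - (c * t)%:C * z_bot w)
    < c * cabs (d + t%:C * z_bot w).
Proof.
move=> a p s w01 q0 qa c0.
have /andP[z0 z1] := cabs_z_bot w01.
have vp0 : 0 < varpi w by rewrite -cabs_z_bot_sqr exprn_gt0.
have sE : s = p - q by rewrite /s /p; field; rewrite gt_eqF ?subr_gt0.
have p0 : q <= p.
  rewrite /p -lerBlDl; apply: le_trans (_ : 0 <= _); first lra.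
  by rewrite divr_ge0 ?sqr_ge0 //; lra.
have ps : 0 <= p ^+ 2 - s ^+ 2 by rewrite sE; nra.
rewrite invfM mulrA ltr_pdivrMr //.
move=> /(quadratic_root_gt c0 ps)[u0 hu].
have t0 : 0 < t by move: u0; rewrite pmulr_lgt0.
split=> //.
rewrite sE in hu.
have := shift_gap q0 qa c0 u0 hu.
have -> : Num.sqrt ((a - c * (t * varpi w)) ^+ 2 + omega_im w d ^+ 2) =
    cabs (z_bot w) * cabs (d - (c * t)%:C * z_bot w).
  have -> : d - (c * t)%:C * z_bot w = d + (- (c * t))%:C * z_bot w.
    by rewrite rmorphN mulNr.
  rewrite omega_coord omega_reD omega_imD.
  by rewrite omega_re_z_bot omega_im_z_bot addr0 mulNr mulrA.
have -> : Num.sqrt ((a + t * varpi w) ^+ 2 + omega_im w d ^+ 2) =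
    cabs (z_bot w) * cabs (d + t%:C * z_bot w).
  by rewrite omega_coord omega_reD omega_imD omega_re_z_bot omega_im_z_bot addr0.
have := cabs_ge0 (d - (c * t)%:C * z_bot w).
have := cabs_ge0 (d + t%:C * z_bot w).
move: (cabs (d - _)) (cabs (d + _)) (cabs (z_bot w)) z0 z1.
move=> v u z z0 z1 u0' v0 h; rewrite -(ltr_pM2l z0).
apply: le_lt_trans (_ : (1 + c) * q + z * v < _); last by rewrite mulrCA.
rewrite mulrDr lerD2r; apply: ler_piMl => //; nra.
Qed.

End ParameterCondition.

(** * Real sequences and finite families *)

Section RealEstimates.
Context {R : realType}.

Lemma uniform_gap (I : finType) (f g : I -> R) :
  (forall i, 0 <= f i) -> (forall i, f i < g i) ->
  exists k : R, [/\ 0 < k, k < 1 & forall i, f i < k * g i].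
Proof.
move=> f0 fg.
have g0 i : 0 < g i by exact: le_lt_trans (fg i).
pose k0 := \big[Order.max/0]_i (f i / g i).
have k00 : 0 <= k0 by exact: bigmax_ge_id.
have k01 : k0 < 1.
  apply/bigmax_ltP; split=> // i _.
  by rewrite ltr_pdivrMr ?mul1r.
exists ((k0 + 1) / 2); split; try lra.
move=> i; apply: le_lt_trans (_ : k0 * g i < _).
  by rewrite -ler_pdivrMr //; exact: (le_bigmax _ (fun i => f i / g i)).
by rewrite ltr_pM2r //; lra.
Qed.

Lemma geometric_lt (k a B : R) : 0 <= k < 1 -> 0 < a ->
  exists N, forall n, (N <= n)%N -> B * k ^+ n < a.
Proof.
move=> /andP[k0 k1] a0.
have [B0|B0] := lerP B 0.
  exists 0%N => n _; apply: le_lt_trans a0.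
  by rewrite mulr_le0_ge0 ?exprn_ge0.
have /cvg_expr /cvgrPdist_lt /(_ (a / B)) : `|k| < 1 by rewrite ger0_norm.
move=> []; first by rewrite divr_gt0.
move=> N _ hN; exists N => n /hN /=.
by rewrite sub0r normrN ger0_norm ?exprn_ge0 // ltr_pdivlMr // mulrC.
Qed.

(** A two-point boundary problem on the half line: [a] is controlled from the
    past and [b] from the future, so boundedness plays the role of the missing
    condition at infinity. *)
Lemma bounded_recursion (k B : R) (a b : nat -> R) :
  0 <= k < 1 ->
  (forall j, 0 <= a j) ->
  (forall j, a j <= B) -> (forall j, b j <= B) ->
  (forall j, a j.+1 <= k * Order.max (a j) (b j.+1)) ->
  (forall j, b j <= k * Order.max (a j) (b j.+1)) ->
  b 0%N <= k * a 0%N.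
Proof.
move=> k01 a0 aB bB ha hb; have /andP[k0 k1] := k01.
have B0 : 0 <= B := le_trans (a0 0%N) (aB 0%N).
(* Each use of the recursion gains a factor [k] on the a priori bound. *)
have key n j : a j.+1 <= Order.max (k * a 0%N) (B * k ^+ n) /\
               b j <= Order.max (k * a 0%N) (B * k ^+ n).
  elim: n j => [|n IHn] j; first by rewrite expr0 mulr1 !le_max aB bB !orbT.
  have step x : x <= Order.max (a 0%N) (B * k ^+ n) ->
      k * x <= Order.max (k * a 0%N) (B * k ^+ n.+1).
    move=> hx; apply: le_trans (ler_wpM2l k0 hx) _.
    by rewrite maxr_pMr // exprS (mulrCA B).
  have low x : x <= Order.max (k * a 0%N) (B * k ^+ n) ->
      x <= Order.max (a 0%N) (B * k ^+ n).
    move/le_trans; apply; rewrite ge_max !le_max lexx orbT andbT.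
    by apply/orP; left; rewrite ler_piMl // ltW.
  have m : Order.max (a j) (b j.+1) <= Order.max (a 0%N) (B * k ^+ n).
    rewrite ge_max (low _ (IHn j.+1).2) andbT.
    case: j => [|j]; first by rewrite le_max lexx.
    exact: low (IHn j).1.
  by split; [apply: le_trans (ha j) _|apply: le_trans (hb j) _]; apply: step.
rewrite leNgt; apply/negP => lt.
have b0 : 0 < b 0%N by apply: le_lt_trans lt; rewrite mulr_ge0.
(* Now let [n] tend to infinity in [key]. *)
have [n /(_ n (leqnn n)) hn] := geometric_lt B k01 b0.
have [_] := key n 0%N; rewrite le_max => /orP[|]; apply/negP; rewrite -ltNge //.
Qed.

End RealEstimates.

(** * Sup norm of column vectors *)

Section SupNorm.
Context {R : realType}.

Definition vmax (p : nat) (x : 'cV[R[i]]_p) : R :=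
  \big[Order.max/0]_i cabs (x i 0).

Lemma vmax_ge0 p (x : 'cV[R[i]]_p) : 0 <= vmax x.
Proof. exact: bigmax_ge_id. Qed.

Lemma le_vmax p (x : 'cV[R[i]]_p) i : cabs (x i 0) <= vmax x.
Proof. exact: (le_bigmax _ (fun i => cabs (x i 0))). Qed.

Lemma vmax_leP p (x : 'cV[R[i]]_p) (M : R) :
  0 <= M -> (forall i, cabs (x i 0) <= M) -> vmax x <= M.
Proof. by move=> M0 h; apply/bigmax_leP; split. Qed.

Lemma vmax_eq0 p (x : 'cV[R[i]]_p) : vmax x <= 0 -> x = 0.
Proof.
move=> x0; apply/matrixP => i j; rewrite ord1 mxE; apply: cabs_eq0.
by apply/eqP; rewrite eq_le cabs_ge0 andbT (le_trans (le_vmax x i)).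
Qed.

Lemma vmax0 p : vmax (0 : 'cV[R[i]]_p) = 0.
Proof.
apply/eqP; rewrite eq_le vmax_ge0 andbT; apply: vmax_leP => // i.
by rewrite mxE cabs0.
Qed.

Lemma vmaxD p (x y : 'cV[R[i]]_p) : vmax (x + y) <= vmax x + vmax y.
Proof.
apply: vmax_leP => [|i]; first by rewrite addr_ge0 ?vmax_ge0.
by rewrite mxE (le_trans (cabsD _ _)) // lerD ?le_vmax.
Qed.

Lemma vmaxN p (x : 'cV[R[i]]_p) : vmax (- x) = vmax x.
Proof. by apply: eq_bigr => i _; rewrite mxE cabsN. Qed.

Lemma vmaxZ p a (x : 'cV[R[i]]_p) : vmax (a *: x) <= cabs a * vmax x.
Proof.
apply: vmax_leP => [|i]; first by rewrite mulr_ge0 ?vmax_ge0 ?cabs_ge0.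
by rewrite mxE cabsM ler_wpM2l ?cabs_ge0 ?le_vmax.
Qed.

Lemma vmax_mulmx p q (X : 'M[R[i]]_(p, q)) :
  exists2 K, 0 <= K & forall x : 'cV_q, vmax (X *m x) <= K * vmax x.
Proof.
exists (\sum_i \sum_j cabs (X i j)) => [|x].
  by do 2!apply: sumr_ge0 => ? _; exact: cabs_ge0.
apply: vmax_leP => [|i].
  apply: mulr_ge0; last exact: vmax_ge0.
  by do 2!apply: sumr_ge0 => ? _; exact: cabs_ge0.
rewrite mxE (le_trans (cabs_sum _ _)) //.
rewrite (bigD1 i) //= mulrDl ler_wpDr //.
  apply: mulr_ge0; last exact: vmax_ge0.
  by do 2!apply: sumr_ge0 => ? _; exact: cabs_ge0.
rewrite mulr_suml; apply: ler_sum => j _.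
by rewrite cabsM ler_wpM2l ?cabs_ge0 ?le_vmax.
Qed.

End SupNorm.

(** * Diagonal dominance and Gershgorin discs *)

Section DiagonalDominance.
Context {R : realType}.

Lemma exists_max (I : finType) (f : I -> R) (i0 : I) :
  exists i, forall j, f j <= f i.
Proof. by case: (arg_maxP f (erefl (predT i0))) => i _ h; exists i => j; exact: h. Qed.

Lemma mulmx_row_split N (Q : 'M[R[i]]_N) (x : 'cV_N) i :
  (Q *m x) i 0 = Q i i * x i 0 + \sum_(j | j != i) Q i j * x j 0.
Proof. by rewrite mxE (bigD1 i). Qed.

Lemma offdiag_sum_ge0 N (Q : 'M[R[i]]_N) i : 0 <= offdiag_sum Q i.
Proof. by apply: sumr_ge0 => j _; exact: cabs_ge0. Qed.

Lemma offdiag_bound N (Q : 'M[R[i]]_N) (x : 'cV_N) (M : R) i :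
  (forall j, cabs (x j 0) <= M) ->
  cabs (\sum_(j | j != i) Q i j * x j 0) <= offdiag_sum Q i * M.
Proof.
move=> h; rewrite (le_trans (cabs_sum _ _)) // mulr_suml.
by apply: ler_sum => j _; rewrite cabsM ler_wpM2l ?cabs_ge0.
Qed.

Lemma gershgorin N (Q : 'M[R[i]]_N) (mu : 'I_N -> R[i]) (x : 'cV_N) :
  x != 0 -> (forall i, (Q *m x) i 0 = mu i * x i 0) ->
  exists i, cabs (Q i i - mu i) <= offdiag_sum Q i.
Proof.
move=> /cV0Pn[i0 xi0] Qx.
have [i hi] := exists_max (fun i => cabs (x i 0)) i0.
have xi : 0 < cabs (x i 0).
  by apply: lt_le_trans (hi i0); rewrite cabs_gt0.
exists i; rewrite -(ler_pM2r xi) -cabsM.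
have -> : (Q i i - mu i) * x i 0 = - \sum_(j | j != i) Q i j * x j 0.
  by rewrite mulrBl -Qx mulmx_row_split; ring.
by rewrite cabsN; apply: offdiag_bound.
Qed.

(** The index where [cabs (y i 0) / b i] is largest decides.  The constancy of
    [a i + b i] is what lets unequal weights pass through the off-diagonal
    terms at no cost. *)
Lemma weighted_dominance N (Q : 'M[R[i]]_N) (d e : 'I_N -> R[i])
    (a b : 'I_N -> R) (s k M : R) (x y : 'cV_N) :
  0 < k <= 1 ->
  (forall i, 0 <= a i) -> (forall i, 0 < b i) -> (forall i, a i + b i = s) ->
  (forall i, s * offdiag_sum Q i + cabs (Q i i - e i) * a i
             < k * (cabs (Q i i + d i) * b i)) ->
  (forall i, (Q *m y) i 0 + d i * y i 0 = (Q *m x) i 0 - e i * x i 0) ->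
  0 <= M -> (forall i, cabs (x i 0) <= a i * M) ->
  forall i, cabs (y i 0) <= k * (b i * M).
Proof.
move=> /andP[k0 k1] a0 b0 ab dom yx M0 xM i0.
have [i hi] := exists_max (fun i => cabs (y i 0) / b i) i0.
set Y := cabs (y i 0) / b i in hi.
have Y0 : 0 <= Y by rewrite divr_ge0 ?cabs_ge0 ?ltW.
have yY j : cabs (y j 0) <= b j * Y by rewrite mulrC -ler_pdivrMr.
suff YM : Y <= k * M.
  by apply: le_trans (yY i0) _; rewrite (mulrCA k) ler_pM2l.
rewrite leNgt; apply/negP => MY.
have MY' : M <= Y / k by rewrite ler_pdivlMr // mulrC ltW.
have Ypos : 0 < Y by apply: le_lt_trans MY; exact: (mulr_ge0 (ltW k0) M0).
have Yk0 : 0 < Y / k by rewrite divr_gt0.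
have YYk : Y <= Y / k by rewrite ler_pdivlMr // ler_piMr // ltW.
have eqi : (Q i i + d i) * y i 0 = (Q i i - e i) * x i 0
    + \sum_(j | j != i) Q i j * (x - y) j 0.
  under eq_bigr do rewrite !mxE mulrBr.
  rewrite sumrB; have := yx i; rewrite !mulmx_row_split.
  set sx := \sum_(_ | _) _ * x _ _; set sy := \sum_(_ | _) _ * y _ _ => h.
  have -> : (Q i i + d i) * y i 0 = Q i i * y i 0 + sy + d i * y i 0 - sy by ring.
  by rewrite h; ring.
have h1 : cabs (\sum_(j | j != i) Q i j * (x - y) j 0)
    <= offdiag_sum Q i * (s * (Y / k)).
  apply: offdiag_bound => j; rewrite !mxE -(ab j) mulrDl.
  apply: le_trans (cabsB _ _) _; apply: lerD.
    by apply: le_trans (xM j) _; rewrite ler_wpM2l.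
  by apply: le_trans (yY j) _; rewrite ler_wpM2l // ltW.
have h2 : cabs ((Q i i - e i) * x i 0) <= cabs (Q i i - e i) * a i * (Y / k).
  rewrite cabsM -mulrA ler_wpM2l ?cabs_ge0 //.
  by apply: le_trans (xM i) _; rewrite ler_wpM2l.
have h3 : cabs (Q i i + d i) * b i * Y <=
    (s * offdiag_sum Q i + cabs (Q i i - e i) * a i) * (Y / k).
  have -> : cabs (Q i i + d i) * b i * Y = cabs ((Q i i + d i) * y i 0).
    by rewrite cabsM /Y; field; rewrite gt_eqF.
  rewrite eqi (le_trans (cabsD _ _)) // [leRHS]mulrDl [leRHS]addrC lerD //.
  by rewrite (mulrC s) -mulrA.
have := dom i; apply/negP; rewrite -leNgt -(ler_pM2r Yk0).
by rewrite mulrC (mulrA (Y / k)) divfK ?gt_eqF // mulrC.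
Qed.

Lemma unitmx_inj N (X : 'M[R[i]]_N) :
  (forall x : 'cV_N, X *m x = 0 -> x = 0) -> X \in unitmx.
Proof.
move=> h; rewrite -unitmx_tr -row_free_unit -kermx_eq0; apply/eqP/row_matrixP => i.
rewrite row0; apply: trmx_inj; rewrite trmx0; apply: h.
by apply: trmx_inj; rewrite trmx_mul trmxK trmx0 -row_mul mulmx_ker row0.
Qed.

Lemma eigenvalue_col N (X : 'M[R[i]]_N) l :
  eigenvalue X l <-> exists2 x : 'cV_N, x != 0 & X *m x = l *: x.
Proof.
rewrite /eigenvalue /eigenspace kermx_eq0 row_free_unit; split=> [/negP h|[x x0 xl]].
  apply: contra_notP h => h; apply: unitmx_inj => x.
  rewrite mulmxBl mul_scalar_mx => /subr0_eq xl.
  by apply/eqP; apply: contraT => x0; case: h; exists x.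
apply: contra x0 => u; rewrite -(mulKmx u x) mulmxBl mul_scalar_mx xl.
by rewrite subrr mulmx0.
Qed.

Lemma dominant_unit N (Q : 'M[R[i]]_N) (l : R[i]) :
  (forall i, offdiag_sum Q i < cabs (Q i i + l)) -> Q + l%:M \in unitmx.
Proof.
move=> dom; apply: unitmx_inj => x Qx; apply/eqP/contraT => x0.
have [i|i] := gershgorin (Q := Q) (mu := fun=> - l) x0.
  move/matrixP/(_ i 0): Qx; rewrite mulmxDl mul_scalar_mx !mxE => /eqP.
  by rewrite addr_eq0 => /eqP ->; rewrite mulNr.
by rewrite opprK leNgt dom.
Qed.

End DiagonalDominance.

(** * Doubling steps preserve contractions *)

Section Contraction.
Context {R : realType} {m n : nat}.
Implicit Types (S : @adda_state R m n).

(** The signs are those of the iteration matrix [[E, -G], [-H, F]]; the sizes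
    of [x1] and [x2] are measured in units [1] and [c] on input, [c] and [1] on
    output.  The exchange of units matches unequal parameters: for
    [alpha = t z], [beta = c t z] and large [t] the initial [E] and [F] are
    close to [- c] and [- 1 / c]. *)
Definition contractive (k c : R) S : Prop :=
  forall (x1 : 'cV_n) (x2 : 'cV_m) (M : R),
    0 <= M -> vmax x1 <= M -> vmax x2 <= c * M ->
    vmax (Ek S *m x1 - Gk S *m x2) <= k * (c * M) /\
    vmax (Fk S *m x2 - Hk S *m x1) <= k * M.

Lemma contractive_H k c S : 0 < c -> contractive k c S ->
  forall x, vmax (Hk S *m x) <= k * vmax x.
Proof.
move=> c0 con x.
have x20 : vmax (0 : 'cV[R[i]]_m) <= c * vmax x.
  by rewrite vmax0 mulr_ge0 ?vmax_ge0 // ltW.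
have [_] := con x 0 _ (vmax_ge0 x) (lexx _) x20.
by rewrite mulmx0 sub0r vmaxN.
Qed.

Lemma contractive_F k c S : 0 < c -> contractive k c S ->
  forall x, c * vmax (Fk S *m x) <= k * vmax x.
Proof.
move=> c0 con x.
have M0 : 0 <= vmax x / c by rewrite divr_ge0 ?vmax_ge0 // ltW.
have [||_] := con 0 x _ M0; first by rewrite vmax0.
  by rewrite mulrC divfK ?gt_eqF.
by rewrite mulmx0 subr0 mulrA ler_pdivlMr // mulrC.
Qed.

Lemma contractive_G k c S : 0 < c -> contractive k c S ->
  forall x, vmax (Gk S *m x) <= k * vmax x.
Proof.
move=> c0 con x.
have M0 : 0 <= vmax x / c by rewrite divr_ge0 ?vmax_ge0 // ltW.
have [||+ _] := con 0 x _ M0; first by rewrite vmax0.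
  by rewrite mulrC divfK ?gt_eqF.
by rewrite mulmx0 sub0r vmaxN (mulrC c) divfK ?gt_eqF.
Qed.

(** A fixed point of [X Y] satisfies [vmax x <= k ^+ 2 * vmax x]. *)
Lemma contraction_unit p q (X : 'M[R[i]]_(p, q)) (Y : 'M[R[i]]_(q, p)) (k : R) :
  0 <= k < 1 ->
  (forall x, vmax (X *m x) <= k * vmax x) ->
  (forall x, vmax (Y *m x) <= k * vmax x) ->
  1%:M - X *m Y \in unitmx.
Proof.
move=> /andP[k0 k1] hX hY; apply: unitmx_inj => x.
rewrite mulmxBl mul1mx -mulmxA => /subr0_eq xE; apply: vmax_eq0.
have := hX (Y *m x); rewrite -xE => h1; have := hY x => h2.
have := vmax_ge0 x; have := vmax_ge0 (Y *m x); nra.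
Qed.

Lemma contractive_unit k c S : 0 <= k < 1 -> 0 < c -> contractive k c S ->
  1%:M - Gk S *m Hk S \in unitmx /\ 1%:M - Hk S *m Gk S \in unitmx.
Proof.
move=> k01 c0 con; split; apply: contraction_unit k01 _ _;
  by [exact: contractive_G con|exact: contractive_H con].
Qed.

(** In the feedback loop [u = E x1 - G v], [v = F x2 - H u] the new outputs are
    [E u - G x2] and [F v - H x1].  The two contraction estimates for [u] and
    [v] depend on one another, but since [k < 1] they can be solved. *)
Lemma contractive_step k c S : 0 <= k < 1 -> 0 < c ->
  contractive k c S -> contractive k (c ^+ 2) (adda_step S).
Proof.
move=> k01 c0 con x1 x2 M M0 x1M x2M.
have [uGH uHG] := contractive_unit k01 c0 con.
case: S con uGH uHG => E F G H /= con uGH uHG.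
have /andP[k0 k1] := k01.
pose u := invmx (1%:M - G *m H) *m (E *m x1 - G *m (F *m x2)).
pose v := F *m x2 - H *m u.
have uE : u = E *m x1 - G *m v.
  have : (1%:M - G *m H) *m u = E *m x1 - G *m (F *m x2) by rewrite mulKVmx.
  rewrite mulmxBl mul1mx /v mulmxBr -mulmxA => /(canRL (subrK _)) {1}->.
  by rewrite opprB addrA [RHS]addrAC.
have vE : v = invmx (1%:M - H *m G) *m (F *m x2 - H *m (E *m x1)).
  apply: (canRL (mulKmx uHG)); rewrite mulmxBl mul1mx.
  have -> : H *m (E *m x1) = H *m u + H *m G *m v.
    by rewrite [in H *m u]uE mulmxBr -mulmxA subrK.
  by rewrite /v opprD addrA.
have -> : (E *m invmx (1%:M - G *m H) *m E) *m x1 -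
    (G + E *m invmx (1%:M - G *m H) *m G *m F) *m x2 = E *m u - G *m x2.
  by rewrite mulmxDl /u !mulmxBr -!mulmxA opprD (addrC (- (G *m x2))) addrA.
have -> : (F *m invmx (1%:M - H *m G) *m F) *m x2 -
    (H + F *m invmx (1%:M - H *m G) *m H *m E) *m x1 = F *m v - H *m x1.
  by rewrite mulmxDl vE !mulmxBr -!mulmxA opprD (addrC (- (H *m x1))) addrA.
have cM0 : 0 <= c * M by rewrite mulr_ge0 // ltW.
have x2M' : vmax x2 <= c * (c * M) by rewrite mulrA -expr2.
have first : vmax u <= k * (c * Order.max M (vmax v / c)).
  rewrite uE; apply: (con x1 v _ _ _ _).1.
  - by rewrite le_max M0.
  - by rewrite le_max x1M.
  - by rewrite -ler_pdivrMl // mulrC le_max lexx orbT.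
have last : vmax v <= k * Order.max (vmax u) (c * M).
  apply: (con u x2 _ _ _ _).2.
  - by rewrite le_max cM0 orbT.
  - by rewrite le_max lexx.
  - apply: le_trans x2M' _; apply: ler_wpM2l; first exact: ltW.
    by rewrite le_max lexx orbT.
have [ucM vcM] : vmax u <= c * M /\ vmax v <= c * M.
  have cmax : c * Order.max M (vmax v / c) = Order.max (c * M) (vmax v).
    by rewrite maxr_pMr ?(ltW c0) // (mulrCA c) mulfV ?gt_eqF // mulr1.
  move: first; rewrite cmax.
  have := vmax_ge0 u; have := vmax_ge0 v.
  case: (lerP (c * M) (vmax v)) => h; move: last;
    case: (lerP (vmax u) (c * M)) => h' *; split; nra.
split.
- have -> : k * (c ^+ 2 * M) = k * (c * (c * M)) by ring.
  exact: (con u x2 _ cM0 ucM x2M').1.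
- exact: (con x1 v _ M0 x1M vcM).2.
Qed.

Lemma contractive_iter k c S j : 0 <= k < 1 -> 0 < c -> contractive k c S ->
  contractive k (c ^+ (2 ^ j)) (iter j adda_step S).
Proof.
move=> k01 c0 con; elim: j => [|j IHj]; first by rewrite expn0 expr1.
by rewrite expnSr exprM iterS; apply: contractive_step; rewrite ?exprn_gt0.
Qed.

End Contraction.

(** * Rows of the coefficient matrix *)

Section BlockRows.
Context {R : realType} {m n : nat}.

Definition blockwise (T : Type) (u v : T) (i : 'I_(n + m)) : T :=
  match fintype.split i with inl _ => u | inr _ => v end.

Lemma blockwise_l T (u v : T) i : blockwise u v (lshift m i) = u.
Proof. by rewrite /blockwise (unsplitK (inl i)). Qed.

Lemma blockwise_r T (u v : T) i : blockwise u v (rshift n i) = v.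
Proof. by rewrite /blockwise (unsplitK (inr i)). Qed.

Lemma ord_shiftP (P : 'I_(n + m) -> Prop) :
  (forall i, P (lshift m i)) -> (forall i, P (rshift n i)) -> forall i, P i.
Proof. by move=> Pl Pr i; case: (split_ordP i) => j ->. Qed.

Implicit Types (A : 'M[R[i]]_m) (B : 'M[R[i]]_(m, n)).
Implicit Types (C : 'M[R[i]]_(n, m)) (D : 'M[R[i]]_n).

Lemma coef_mx_ll A B C D i : coef_mx A B C D (lshift m i) (lshift m i) = D i i.
Proof. exact: block_mxEul. Qed.

Lemma coef_mx_rr A B C D i : coef_mx A B C D (rshift n i) (rshift n i) = A i i.
Proof. exact: block_mxEdr. Qed.

Lemma coef_mx_mul A B C D x1 x2 :
  coef_mx A B C D *m col_mx x1 x2 =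
  col_mx (D *m x1 - C *m x2) (A *m x2 - B *m x1) :> 'cV_(n + m).
Proof. by rewrite /coef_mx mul_block_col !mulNmx (addrC (- _)). Qed.

Lemma offdiag_coef_l A B C D i :
  offdiag_sum (coef_mx A B C D) (lshift m i) =
  offdiag_sum D i + \sum_j cabs (C i j).
Proof.
rewrite /offdiag_sum big_split_ord /=; congr (_ + _); apply: eq_big => j.
- by rewrite (inj_eq (@lshift_inj _ _)).
- by move=> _; rewrite /coef_mx block_mxEul.
- by rewrite eq_rlshift.
- by move=> _; rewrite /coef_mx block_mxEur mxE cabsN.
Qed.

Lemma offdiag_coef_r A B C D i :
  offdiag_sum (coef_mx A B C D) (rshift n i) =
  offdiag_sum A i + \sum_j cabs (B i j).
Proof.
rewrite /offdiag_sum big_split_ord /= addrC; congr (_ + _); apply: eq_big => j.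
- by rewrite (inj_eq (@rshift_inj _ _)).
- by move=> _; rewrite /coef_mx block_mxEdr.
- by rewrite eq_lrshift.
- by move=> _; rewrite /coef_mx block_mxEdl mxE cabsN.
Qed.

End BlockRows.

(** * Invertibility of the shifted matrices *)

Section ShiftDominance.
Context {R : realType}.

(** The factor [1 + c] is the sum of the input and output units of a
    coordinate, which is the same in both blocks. *)
Definition shift_dominant (m n : nat) (A : 'M[R[i]]_m) (B : 'M[R[i]]_(m, n))
    (C : 'M[R[i]]_(n, m)) (D : 'M[R[i]]_n) (alpha beta : R[i]) (c : R) : Prop :=
  (forall i, (1 + c) * offdiag_sum (coef_mx A B C D) (lshift m i)
      + cabs (D i i - beta) < c * cabs (D i i + alpha)) /\
  (forall i, (1 + c) * offdiag_sum (coef_mx A B C D) (rshift n i)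
      + c * cabs (A i i - alpha) < cabs (A i i + beta)).

Lemma shift_dominant_swap m n (A : 'M[R[i]]_m) (B : 'M[R[i]]_(m, n))
    (C : 'M[R[i]]_(n, m)) (D : 'M[R[i]]_n) alpha beta c : 0 < c ->
  shift_dominant A B C D alpha beta c -> shift_dominant D C B A beta alpha c^-1.
Proof.
move=> c0 [domD domA]; have c0' : c != 0 by rewrite gt_eqF.
split=> i.
- rewrite offdiag_coef_l -(offdiag_coef_r A B C D i).
  rewrite -(ltr_pM2l c0) mulrDr !mulrA mulfV // mul1r mulrDr mulr1 mulfV //.
  by rewrite (addrC c) domA.
- rewrite offdiag_coef_r -(offdiag_coef_l A B C D i).
  rewrite -(ltr_pM2l c0) mulrDr !mulrA mulfV // mul1r mulrDr mulr1 mulfV //.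
  by rewrite (addrC c) domD.
Qed.

Context {m n : nat}.
Variables (A : 'M[R[i]]_m) (B : 'M[R[i]]_(m, n)).
Variables (C : 'M[R[i]]_(n, m)) (D : 'M[R[i]]_n).
Variables (alpha beta : R[i]) (c : R).
Hypothesis c0 : 0 < c.
Hypothesis dom : shift_dominant A B C D alpha beta c.

Local Notation Aβ := (A_shift A beta).
Local Notation Dα := (D_shift D alpha).

(** The two matrix equations say that [(y1, y2)] is the image of [(x1, x2)] under
    [(Q + diag(alpha, beta))^-1 (Q - diag(beta, alpha))]; phrasing them without
    the inverse makes the estimate available for proving invertibility. *)
Lemma block_dominance : exists k, [/\ 0 < k, k < 1 &
  forall (x1 y1 : 'cV_n) (x2 y2 : 'cV_m) (M : R),
    0 <= M -> vmax x1 <= M -> vmax x2 <= c * M ->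
    Dα *m y1 - C *m y2 = (D - beta%:M) *m x1 - C *m x2 ->
    Aβ *m y2 - B *m y1 = (A - alpha%:M) *m x2 - B *m x1 ->
    vmax y1 <= k * (c * M) /\ vmax y2 <= k * M].
Proof.
pose Q := coef_mx A B C D.
pose d := @blockwise m n _ alpha beta; pose e := @blockwise m n _ beta alpha.
pose a := @blockwise m n _ 1 c; pose b := @blockwise m n _ c 1.
have c1 : 0 <= 1 + c by rewrite addr_ge0 // ltW.
have a0 i : 0 <= a i.
  by move: i; apply: ord_shiftP => i; rewrite /a ?(blockwise_l, blockwise_r) ?ltW.
have b0 i : 0 < b i.
  by move: i; apply: ord_shiftP => i; rewrite /b ?(blockwise_l, blockwise_r).
have ab i : a i + b i = 1 + c.
  move: i; apply: ord_shiftP => i; rewrite /a /b ?(blockwise_l, blockwise_r) //.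
  by rewrite addrC.
have [|i|k [k0 k1 hk]] := @uniform_gap R 'I_(n + m)
  (fun i => (1 + c) * offdiag_sum Q i + cabs (Q i i - e i) * a i)
  (fun i => cabs (Q i i + d i) * b i).
- move=> i; rewrite addr_ge0 // mulr_ge0 ?cabs_ge0 //.
  exact: offdiag_sum_ge0.
- have [domD domA] := dom.
  move: i; apply: ord_shiftP => i.
    rewrite /Q coef_mx_ll /d /e /a /b !blockwise_l mulr1 (mulrC _ c).
    exact: domD.
  rewrite /Q coef_mx_rr /d /e /a /b !blockwise_r mulr1 (mulrC _ c).
  exact: domA.
exists k; split=> // x1 y1 x2 y2 M M0 x1M x2M eq1 eq2.
have bnd := @weighted_dominance R _ Q d e a b (1 + c) k M (col_mx x1 x2) (col_mx y1 y2).
have {}bnd i : cabs (col_mx y1 y2 i 0) <= k * (b i * M).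
  apply: bnd => //; first by rewrite k0 ltW.
  - rewrite /Q !coef_mx_mul; apply: ord_shiftP => j.
      rewrite !col_mxEu /d /e !blockwise_l.
      have := congr1 (fun X : 'cV_n => X j 0) eq1.
      rewrite mulmxDl mulmxBl !mul_scalar_mx !mxE => h.
      by rewrite addrAC h addrAC.
    rewrite !col_mxEd /d /e !blockwise_r.
    have := congr1 (fun X : 'cV_m => X j 0) eq2.
    rewrite mulmxDl mulmxBl !mul_scalar_mx !mxE => h.
    by rewrite addrAC h addrAC.
  apply: ord_shiftP => j; rewrite /a ?(blockwise_l, blockwise_r).
    by rewrite col_mxEu mul1r (le_trans (le_vmax _ _)).
  by rewrite col_mxEd (le_trans (le_vmax _ _)).
split; apply: vmax_leP => [|i]; rewrite ?mulr_ge0 ?(ltW k0) ?(ltW c0) //.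
  by have := bnd (lshift m i); rewrite col_mxEu /b blockwise_l.
by have := bnd (rshift n i); rewrite col_mxEd /b blockwise_r mul1r.
Qed.

Lemma D_shift_unit : Dα \in unitmx.
Proof.
apply: dominant_unit => i; rewrite -(ltr_pM2l c0); apply: le_lt_trans (dom.1 i).
rewrite offdiag_coef_l ler_wpDr ?cabs_ge0 //.
apply: ler_pM; rewrite ?(ltW c0) ?offdiag_sum_ge0 ?lerDr ?lerDl //.
by apply: sumr_ge0 => j _; exact: cabs_ge0.
Qed.

Lemma A_shift_unit : Aβ \in unitmx.
Proof.
apply: dominant_unit => i; apply: le_lt_trans (dom.2 i).
rewrite offdiag_coef_r ler_wpDr ?mulr_ge0 ?cabs_ge0 ?(ltW c0) //.
rewrite -[leLHS]mul1r.
apply: ler_pM; rewrite ?offdiag_sum_ge0 ?lerDl ?(ltW c0) //.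
by apply: sumr_ge0 => j _; exact: cabs_ge0.
Qed.

(** A kernel vector [x] of the Schur complement [W] extends to the kernel vector
    [(Dα^-1 C x, x)] of [Q + diag(alpha, beta)]. *)
Lemma W_mx_unit : W_mx A B C D alpha beta \in unitmx.
Proof.
apply: unitmx_inj => x Wx; apply: vmax_eq0.
have [k [_ _ est]] := block_dominance.
have v0 p : vmax (0 : 'cV[R[i]]_p) <= 0 by rewrite vmax0.
have v0' : vmax (0 : 'cV[R[i]]_m) <= c * 0 by rewrite vmax0 mulr0.
have eq1 : Dα *m (invmx Dα *m (C *m x)) - C *m x = (D - beta%:M) *m 0 - C *m 0.
  by rewrite mulKVmx ?D_shift_unit // subrr !mulmx0 subrr.
have eq2 : Aβ *m x - B *m (invmx Dα *m (C *m x)) = (A - alpha%:M) *m 0 - B *m 0.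
  by rewrite !mulmx0 subrr -[RHS]Wx /W_mx mulmxBl !mulmxA.
have [_] := est 0 _ 0 x 0 (lexx 0) (v0 n) v0' eq1 eq2.
by rewrite mulr0.
Qed.

End ShiftDominance.

(** Both sides are the same off-diagonal block of the inverse of a two by two
    block matrix, computed from either Schur complement. *)
Lemma push_through (F : fieldType) (p q : nat) (X : 'M[F]_p) (Y : 'M[F]_q) B C :
  X \in unitmx -> Y \in unitmx ->
  X - B *m invmx Y *m C \in unitmx -> Y - C *m invmx X *m B \in unitmx ->
  invmx (X - B *m invmx Y *m C) *m B *m invmx Y =
  invmx X *m B *m invmx (Y - C *m invmx X *m B).
Proof.
move=> uX uY uW uV.
set W := X - _ in uW *; set V := Y - _ in uV *.
apply: (canRL (mulmxK uV)); rewrite -!mulmxA.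
apply: (canLR (mulKmx uW)).
by rewrite /W /V mulmxBr mulmxBl mulVmx // mulKVmx // mulmxBr mulmx1 !mulmxA.
Qed.

(** * The initial state *)

Section InitialState.
Context {R : realType} {m n : nat}.
Variables (A : 'M[R[i]]_m) (B : 'M[R[i]]_(m, n)).
Variables (C : 'M[R[i]]_(n, m)) (D : 'M[R[i]]_n).
Variables (alpha beta : R[i]) (c : R).
Hypothesis c0 : 0 < c.
Hypothesis dom : shift_dominant A B C D alpha beta c.

Local Notation Aβ := (A_shift A beta).
Local Notation Dα := (D_shift D alpha).
Local Notation S0 := (adda_init A B C D alpha beta).

Let cV0 : 0 < c^-1. Proof. by rewrite invr_gt0. Qed.
Let uD : Dα \in unitmx. Proof. exact: D_shift_unit dom. Qed.
Let uA : Aβ \in unitmx. Proof. exact: A_shift_unit dom. Qed.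
Let uW : W_mx A B C D alpha beta \in unitmx. Proof. exact: W_mx_unit dom. Qed.

Lemma V_mx_unit : V_mx A B C D alpha beta \in unitmx.
Proof. exact: (W_mx_unit cV0 (shift_dominant_swap c0 dom)). Qed.

Lemma adda_init_swap :
  adda_init D C B A beta alpha = AddaState (Fk S0) (Ek S0) (Hk S0) (Gk S0).
Proof.
have VW : W_mx D C B A beta alpha = V_mx A B C D alpha beta by [].
have WV : V_mx D C B A beta alpha = W_mx A B C D alpha beta by [].
rewrite /adda_init VW WV (addrC beta).
have pD : invmx (W_mx A B C D alpha beta) *m B *m invmx Dα =
    invmx Aβ *m B *m invmx (V_mx A B C D alpha beta) := push_through uA uD uW V_mx_unit.
have pA : invmx (V_mx A B C D alpha beta) *m C *m invmx Aβ =
    invmx Dα *m C *m invmx (W_mx A B C D alpha beta) := push_through uD uA V_mx_unit uW.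
by rewrite /= pD -pA.
Qed.

(** Second block column of the identity
    [(Q + diag(alpha, beta)) M = Q - diag(beta, alpha)] for the matrix [M] with
    blocks [E0], [-G0], [-H0], [F0], up to signs.  The first block column,
    [init_col1], is this one for the exchanged equation. *)
Lemma init_col2 :
  Dα *m Gk S0 + C *m Fk S0 = C /\ Aβ *m Fk S0 + B *m Gk S0 = A - alpha%:M.
Proof.
rewrite /=; split.
  rewrite -scalemxAr !mulmxA mulmxV // mul1mx mulmxBr mulmx1 -scalemxAr.
  by rewrite addrC subrK.
rewrite mulmxBr mulmx1 -!scalemxAr !mulmxA addrAC -addrA -scalerBr -mulmxBl.
have -> : B *m invmx Dα *m C - Aβ = - W_mx A B C D alpha beta by rewrite opprB.
rewrite mulNmx mulmxV // scalerN scalemx1 addrC (addrC alpha) raddfD opprD.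
by rewrite addrC addrA addrK.
Qed.

End InitialState.

(** * Relations between a solution and the states *)

Lemma block_apply (F : pzRingType) (p q : nat) (X E : 'M[F]_p) (Y G : 'M[F]_(p, q))
    (Z : 'M[F]_q) (H : 'M[F]_(q, p)) (x1 : 'cV_p) (x2 : 'cV_q) :
  X *m (E *m x1 - G *m x2) - Y *m (Z *m x2 - H *m x1) =
  (X *m E + Y *m H) *m x1 - (X *m G + Y *m Z) *m x2.
Proof.
by rewrite !mulmxBr !mulmxDl !mulmxA opprB [in RHS]opprD addrACA.
Qed.

Section Intertwining.
Context {R : realType} {m n : nat}.

(** These relations say that the graph of [P] is invariant for the pencil of the
    doubling algorithm, acting on it as [T]. *)
Definition intertwines (P : 'M[R[i]]_(m, n)) (S : adda_state) (T : 'M[R[i]]_n) : Prop :=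
  T = Ek S + Gk S *m P *m T /\ P = Hk S + Fk S *m P *m T.

Lemma intertwines_step (P : 'M[R[i]]_(m, n)) S (T : 'M[R[i]]_n) :
  1%:M - Gk S *m Hk S \in unitmx -> 1%:M - Hk S *m Gk S \in unitmx ->
  intertwines P S T -> intertwines P (adda_step S) (T *m T).
Proof.
case: S => E F G H /= uGH uHG [/= eT eP].
have eT2 : T *m T = E *m T + G *m P *m (T *m T).
  by rewrite {1}eT mulmxDl !mulmxA.
have ePT : P *m T = H *m T + F *m P *m (T *m T).
  by rewrite {1}eP mulmxDl !mulmxA.
have tE : T = invmx (1%:M - G *m H) *m (E + G *m F *m P *m (T *m T)).
  apply: (canRL (mulKmx uGH)); rewrite mulmxBl mul1mx {1}eT -!(mulmxA G).
  by rewrite ePT mulmxDr !mulmxA addrA addrAC addrK.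
have ptE : P *m T = invmx (1%:M - H *m G) *m (H *m E + F *m P *m (T *m T)).
  apply: (canRL (mulKmx uHG)); rewrite mulmxBl mul1mx {1}ePT {1}eT mulmxDr.
  by rewrite !mulmxA addrAC addrK.
split=> /=.
  rewrite {1}eT2 {1}tE !(mulmxDl, mulmxDr) !mulmxA.
  by rewrite -!addrA (addrC (G *m P *m T *m T)).
rewrite {1}eP -(mulmxA F) ptE !mulmxDr !mulmxA.
by rewrite addrA.
Qed.

End Intertwining.

Section InitialContraction.
Context {R : realType} {m n : nat}.
Variables (A : 'M[R[i]]_m) (B : 'M[R[i]]_(m, n)).
Variables (C : 'M[R[i]]_(n, m)) (D : 'M[R[i]]_n).
Variables (alpha beta : R[i]) (c : R).
Hypothesis c0 : 0 < c.
Hypothesis dom : shift_dominant A B C D alpha beta c.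

Local Notation Aβ := (A_shift A beta).
Local Notation Dα := (D_shift D alpha).
Local Notation S0 := (adda_init A B C D alpha beta).

Lemma init_col1 :
  Dα *m Ek S0 + C *m Hk S0 = D - beta%:M /\ Aβ *m Hk S0 + B *m Ek S0 = B.
Proof.
have cV0 : 0 < c^-1 by rewrite invr_gt0.
have [] := init_col2 cV0 (shift_dominant_swap c0 dom).
by rewrite (adda_init_swap c0 dom).
Qed.

Lemma contractive_init : exists k, [/\ 0 < k, k < 1 & contractive k c S0].
Proof.
have [k [k0 k1 est]] := block_dominance c0 dom.
exists k; split=> // x1 x2 M M0 x1M x2M.
have [eD eB] := init_col1; have [eC eA] := init_col2 c0 dom.
by apply: (est x1 _ x2 _ M M0 x1M x2M); rewrite block_apply ?eD ?eC ?eA ?eB.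
Qed.

Lemma block_injective p (X : 'M[R[i]]_(n, p)) (Y : 'M[R[i]]_(m, p)) :
  Dα *m X = C *m Y -> Aβ *m Y = B *m X -> X = 0 /\ Y = 0.
Proof.
move=> eX eY; have uD := D_shift_unit c0 dom; have uW := W_mx_unit c0 dom.
have XE : X = invmx Dα *m (C *m Y) by rewrite -eX mulKmx.
have Y0 : Y = 0.
  rewrite -(mulKmx uW Y) /W_mx mulmxBl eY -!mulmxA -XE subrr.
  exact: mulmx0.
by rewrite XE Y0 !mulmx0.
Qed.

(** Both defects, of [T] and of [P], solve the homogeneous block system of
    [block_injective], by the Riccati equation. *)
Lemma intertwines_init (P : 'M[R[i]]_(m, n)) (T : 'M[R[i]]_n) :
  riccati_sol A B C D P ->
  (D - C *m P + alpha%:M) *m T = D - C *m P - beta%:M ->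
  intertwines P S0 T.
Proof.
move=> ric Teq.
have [eD eB] := init_col1; have [eC eA] := init_col2 c0 dom.
pose X := T - (Ek S0 + Gk S0 *m P *m T).
pose Y := Hk S0 + Fk S0 *m P *m T - P.
suff [X0 Y0] : X = 0 /\ Y = 0.
  split; first by apply: subr0_eq.
  by apply/esym/subr0_eq.
move: (Ek S0) (Fk S0) (Gk S0) (Hk S0) @X @Y eD eB eC eA => E F G H X Y eD eB eC eA.
have eAP : A *m P = P *m C *m P - P *m D + B.
  move: ric; rewrite /riccati_sol => /eqP; rewrite addrAC subr_eq0 => /eqP <-.
  by [].
have eT : Dα *m T = D - beta%:M - C *m P + C *m P *m T.
  apply: (canRL (subrK _)); rewrite -mulmxBl /D_shift addrAC Teq.
  by rewrite addrAC.
have ePT : P *m D *m T =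
    P *m D - P *m C *m P - beta *: P + P *m C *m P *m T - alpha *: (P *m T).
  have := congr1 (mulmx P) Teq.
  rewrite !mulmxA mulmxDr !mulmxBr mulmxDl mulmxBl !mul_mx_scalar !mulmxA.
  move=> <-; rewrite -scalemxAl.
  by apply/matrixP => i j; rewrite !mxE; ring.
apply: block_injective.
- rewrite /X /Y mulmxBr mulmxDr eT (canRL (addrK _) eD) !mulmxA.
  rewrite (canRL (addrK _) eC) mulmxBr mulmxDr !mulmxBl !mulmxA.
  by apply/matrixP => i j; rewrite !mxE; ring.
- rewrite /X /Y !mulmxBr !mulmxDr (canRL (addrK _) eB) !mulmxA.
  rewrite (canRL (addrK _) eA) /A_shift !mulmxDl !mulNmx eAP !mulmxDl !mulNmx ePT.
  rewrite !mul_scalar_mx -scalemxAl.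
  by apply/matrixP => i j; rewrite !mxE; ring.
Qed.

End InitialContraction.

(** * Powers of a matrix with spectrum in a disc *)

Section PowerBounded.
Context {R : realType}.

(** Peeling one factor [T - z] off the annihilating polynomial leaves the scalar
    recursion [u_(j+1) <= cabs z * u_j + K c ^+ j], harmless for [cabs z < c]. *)
Lemma power_growth p (T : 'M[R[i]]_p.+1) (c : R) (rs : seq R[i]) :
  0 < c -> all (fun z => cabs z < c) rs ->
  forall x : 'cV_p.+1, horner_mx T (\prod_(z <- rs) ('X - z%:P)) *m x = 0 ->
  exists K, forall j, vmax (T ^+ j *m x) <= K * c ^+ j.
Proof.
move=> c0; elim: rs => [_ x|z rs IHrs /= /andP[zc rsc] x].
  rewrite big_nil rmorph1 mul1mx => ->; exists 0 => j.
  by rewrite mulmx0 vmax0 mul0r.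
rewrite big_cons mulrC rmorphM rmorphB /= horner_mx_X horner_mx_C => h.
have [|K hK] := IHrs rsc ((T - z%:M) *m x); first by rewrite mulmxA.
have K0 : 0 <= K.
  by apply: le_trans (vmax_ge0 _) _; have := hK 0%N; rewrite expr0 mulr1; apply.
have cz : 0 < c - cabs z by rewrite subr_gt0.
exists (vmax x + K / (c - cabs z)); elim=> [|j IHj].
  by rewrite !expr0 mul1mx mulr1 lerDl divr_ge0 // ltW.
have -> : T ^+ j.+1 *m x = T ^+ j *m ((T - z%:M) *m x) + z *: (T ^+ j *m x).
  rewrite mulmxBl mul_scalar_mx mulmxBr -scalemxAr subrK exprSr.
  by rewrite mulmxA.
apply: le_trans (vmaxD _ _) _.
apply: le_trans (lerD (hK j) (le_trans (vmaxZ _ _) (ler_wpM2l (cabs_ge0 z) IHj))) _.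
set L := K / _ in IHj *; have KE : K = L * (c - cabs z) by rewrite divfK ?gt_eqF.
rewrite {1}KE exprS -subr_ge0.
have -> : (vmax x + L) * (c * c ^+ j) -
    (L * (c - cabs z) * c ^+ j + cabs z * ((vmax x + L) * c ^+ j)) =
    vmax x * (c - cabs z) * c ^+ j by ring.
by rewrite !mulr_ge0 ?vmax_ge0 ?exprn_ge0 // ltW.
Qed.

(** By the Cayley-Hamilton theorem the linear factors of the characteristic
    polynomial kill every vector, which spares any triangularisation. *)
Lemma power_bounded p (T : 'M[R[i]]_p.+1) (c : R) :
  0 < c -> (forall mu, eigenvalue T mu -> cabs mu < c) ->
  forall x : 'cV_p.+1, exists K, forall j, vmax (T ^+ j *m x) <= K * c ^+ j.
Proof.
move=> c0 ev x.
have [rs] := closed_field_poly_normal (char_poly T).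
rewrite (monicP (char_poly_monic T)) scale1r => rsE.
apply: (power_growth (rs := rs)) => //; last by rewrite -rsE Cayley_Hamilton mul0mx.
apply/allP => z zrs; apply: ev.
by rewrite eigenvalue_root_char rsE root_prod_XsubC.
Qed.

End PowerBounded.

(** * Error of the doubling iteration *)

Section SolutionBound.
Context {R : realType} {m n : nat}.
Variables (P : 'M[R[i]]_(m.+1, n.+1)) (T : 'M[R[i]]_n.+1).
Variables (S : @adda_state R m.+1 n.+1) (k c : R).
Hypotheses (c0 : 0 < c) (k0 : 0 < k) (k1 : k < 1).
Hypothesis con : contractive k c S.
Hypothesis itw : intertwines P S T.

Lemma intertwined_step x :
  let M := Order.max (vmax x) (vmax (P *m (T *m x)) / c) in
  vmax (T *m x) <= k * (c * M) /\ vmax (P *m x) <= k * M.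
Proof.
move=> M; have [eT eP] := itw.
have M0 : 0 <= M by rewrite le_max vmax_ge0.
have x1M : vmax x <= M by rewrite le_max lexx.
have x2M : vmax (- (P *m (T *m x))) <= c * M.
  by rewrite vmaxN mulrC -ler_pdivrMr // le_max lexx orbT.
have [] := con M0 x1M x2M.
have -> : Ek S *m x - Gk S *m (- (P *m (T *m x))) = T *m x.
  by rewrite mulmxN opprK {2}eT mulmxDl !mulmxA.
have -> : Fk S *m (- (P *m (T *m x))) - Hk S *m x = - (P *m x).
  by rewrite mulmxN -opprD addrC {2}eP mulmxDl !mulmxA.
by rewrite vmaxN.
Qed.

Hypothesis bounded :
  forall x : 'cV_n.+1, exists K, forall j, vmax (T ^+ j *m x) <= K * c ^+ j.

(** Along the orbit [T ^+ j x] the sizes of [T ^+ j x] and [P T ^+ j x], rescaled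
    by [c ^+ j], satisfy the coupled recursion of [bounded_recursion]. *)
Lemma solution_contraction x : vmax (P *m x) <= k * vmax x.
Proof.
have [K hK] := bounded x.
have [L L0 hL] := vmax_mulmx P.
have K0 : 0 <= K.
  by apply: le_trans (vmax_ge0 _) _; have := hK 0%N; rewrite expr0 mulr1; apply.
pose a j := vmax (T ^+ j *m x) / c ^+ j.
pose b j := vmax (P *m (T ^+ j *m x)) / c ^+ j.
have cj j : 0 < c ^+ j by rewrite exprn_gt0.
have aK j : a j <= K by rewrite ler_pdivrMr.
have rec j : a j.+1 <= k * Order.max (a j) (b j.+1) /\
             b j <= k * Order.max (a j) (b j.+1).
  have [] := intertwined_step (T ^+ j *m x).
  have -> : T *m (T ^+ j *m x) = T ^+ j.+1 *m x by rewrite mulmxA exprS.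
  set M := Order.max _ _.
  have -> : Order.max (a j) (b j.+1) = M / c ^+ j.
    rewrite /M maxr_pMl ?invr_ge0 ?(ltW (cj j)) // /a /b (exprS c).
    by rewrite invfM mulrA.
  move=> hT hP; split; last by rewrite /b mulrA ler_pM2r ?invr_gt0.
  rewrite /a (exprS c) invfM !mulrA ler_pM2r ?invr_gt0 // ler_pdivrMr //.
  by rewrite mulrAC -mulrA.
have := @bounded_recursion R k (Order.max K (L * K)) a b.
rewrite /a /b expr0 mul1mx !divr1; apply.
- by rewrite (ltW k0).
- by move=> j; rewrite divr_ge0 ?vmax_ge0 ?(ltW (cj j)).
- by move=> j; rewrite le_max aK.
- move=> j; rewrite le_max; apply/orP; right.
  rewrite ler_pdivrMr // -mulrA; apply: le_trans (hL _) _.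
  by rewrite ler_wpM2l.
- by move=> j; exact: (rec j).1.
- by move=> j; exact: (rec j).2.
Qed.

(** Since [P] does not increase sizes, in [intertwined_step] at [x] the maximum
    cannot be attained by its second term unless [T x = 0]. *)
Lemma closed_loop_contraction x : vmax (T *m x) <= k * c * vmax x.
Proof.
have [+ _] := intertwined_step x.
have := solution_contraction (T *m x); have := vmax_ge0 (T *m x).
have := vmax_ge0 x.
move: (vmax x) (vmax (T *m x)) (vmax (P *m (T *m x))) => u v z u0 v0 zv.
have cmax : c * Order.max u (z / c) = Order.max (c * u) z.
  by rewrite maxr_pMr ?(ltW c0) // (mulrCA c) mulfV ?gt_eqF // mulr1.
rewrite cmax -mulrA; case: (lerP (c * u) z) => // uz vz.
have v_0 : v <= 0.
  have := le_trans vz (ler_wpM2l (ltW k0) zv); rewrite mulrA => vkk.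
  rewrite leNgt; apply/negP => vp; move: vkk; apply/negP; rewrite -ltNge.
  by rewrite gtr_pMl // -expr2 exprn_ilt1 ?(ltW k0).
by apply: le_trans v_0 _; rewrite !mulr_ge0 // ltW.
Qed.

Lemma power_contraction j x : vmax (T ^+ j *m x) <= k ^+ j * c ^+ j * vmax x.
Proof.
elim: j => [|j IHj]; first by rewrite !expr0 mul1mx !mul1r.
rewrite exprS -[T * _]/(T *m _) -mulmxA.
apply: le_trans (closed_loop_contraction _) _.
have -> : k ^+ j.+1 * c ^+ j.+1 * vmax x = k * c * (k ^+ j * c ^+ j * vmax x).
  by rewrite !exprS; ring.
by rewrite ler_wpM2l // mulr_ge0 // ltW.
Qed.

Lemma intertwines_iter j :
  intertwines P (iter j adda_step S) (T ^+ (2 ^ j)).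
Proof.
elim: j => [|j IHj]; first by rewrite expn0 expr1.
have k01 : 0 <= k < 1 by rewrite (ltW k0).
have [uGH uHG] : 1%:M - Gk (iter j adda_step S) *m Hk (iter j adda_step S) \in unitmx
    /\ 1%:M - Hk (iter j adda_step S) *m Gk (iter j adda_step S) \in unitmx.
  apply: (@contractive_unit _ _ _ k (c ^+ (2 ^ j))); rewrite ?exprn_gt0 //.
  exact: contractive_iter.
rewrite iterS expnSr muln2 -addnn exprD.
exact: intertwines_step.
Qed.

(** The error is [F P T ^+ (2 ^ j)]: the decay [c ^- (2 ^ j)] of [F] pays
    for the growth of the power of [T]. *)
Lemma doubling_error j x :
  vmax ((Hk (iter j adda_step S) - P) *m x) <= k ^+ (2 ^ j) * vmax x.
Proof.
have k01 : 0 <= k < 1 by rewrite (ltW k0).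
have con_j := contractive_iter (j := j) k01 c0 con.
have [_ eP] := intertwines_iter j.
move: (iter j adda_step S) con_j eP => Sj con_j eP.
move: (2 ^ j)%N con_j eP => N con_j eP.
have cN : 0 < c ^+ N by rewrite exprn_gt0.
rewrite {1}eP opprD addrA subrr sub0r mulNmx vmaxN -!mulmxA.
rewrite -(ler_pM2l cN); apply: le_trans (contractive_F cN con_j _) _.
have kk y z : 0 <= y -> z <= y -> k * z <= y.
  move=> y0 zy; apply: le_trans (ler_wpM2l (ltW k0) zy) _.
  by rewrite ler_piMl // ltW.
have rhs0 : 0 <= c ^+ N * (k ^+ N * vmax x).
  by rewrite !mulr_ge0 ?vmax_ge0 ?exprn_ge0 // ltW.
apply: (kk _ _ rhs0); apply: le_trans (solution_contraction _) _; apply: (kk _ _ rhs0).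
by rewrite mulrA (mulrC (c ^+ N)) power_contraction.
Qed.

End SolutionBound.

(** * Quadratic convergence in an arbitrary norm *)

Section QuadraticRate.
Context {R : realType} {p q : nat}.
Implicit Types (u : nat -> 'M[R[i]]_(p, q)) (L X : 'M[R[i]]_(p, q)).

Lemma is_norm_ge0 (nu : 'M[R[i]]_(p, q) -> R) X : is_norm nu -> 0 <= nu X.
Proof.
move=> [tri hom _].
have nu0 : nu 0 = 0 by have := hom 0 0; rewrite scale0r cabs0 mul0r.
have nuN : nu (- X) = nu X by rewrite -scaleN1r hom cabsN cabs_real normr1 mul1r.
by have := tri X (- X); rewrite subrr nu0 nuN -mulr2n pmulrn_lge0.
Qed.

Lemma is_norm_bound (nu : 'M[R[i]]_(p, q) -> R) : is_norm nu ->
  exists2 K, 0 <= K & forall X (e : R), (forall i j, cabs (X i j) <= e) -> nu X <= K * e.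
Proof.
move=> nun; have [tri hom _] := nun.
exists (\sum_i \sum_j nu (delta_mx i j)) => [|X e Xe].
  by do 2!apply: sumr_ge0 => ? _; exact: is_norm_ge0.
have nu_sum (I : finType) (F : I -> 'M[R[i]]_(p, q)) : nu (\sum_i F i) <= \sum_i nu (F i).
  elim/big_ind2: _ => [|x1 y1 x2 y2 h1 h2|//].
    by have := hom 0 0; rewrite scale0r cabs0 mul0r => ->.
  exact: le_trans (tri _ _) (lerD h1 h2).
rewrite {1}(matrix_sum_delta X) mulr_suml (le_trans (nu_sum _ _)) //.
apply: ler_sum => i _; rewrite mulr_suml (le_trans (nu_sum _ _)) //.
apply: ler_sum => j _; rewrite hom mulrC ler_wpM2l //; exact: is_norm_ge0.
Qed.

(** The constant comparing a norm with the sup norm is absorbed, for large [j],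
    by enlarging the ratio [k] to the midpoint of [k] and [1]. *)
Lemma quadratic_cvg_sup (k : R) u L :
  0 < k < 1 ->
  (forall j (x : 'cV_q), vmax ((u j - L) *m x) <= k ^+ (2 ^ j) * vmax x) ->
  quadratic_cvg u L.
Proof.
move=> /andP[k0 k1] err nu nun.
have [K K0 hK] := is_norm_bound nun.
pose k' := (k + 1) / 2.
have [kk' k'1] : k < k' /\ k' < 1 by split; rewrite /k'; lra.
have k'0 : 0 < k' by exact: lt_trans kk'.
have ratio : 0 <= k / k' < 1.
  by rewrite divr_ge0 ?(ltW k0) ?(ltW k'0) // ltr_pdivrMr // mul1r.
have [N hN] := geometric_lt K ratio ltr01.
have small j : (N <= j)%N -> nu (u j - L) `^ (1 / 2 ^+ j) <= k'.
  move=> Nj.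
  have entry i l : cabs ((u j - L) i l) <= k ^+ (2 ^ j).
    have := le_trans (le_vmax _ i) (err j (delta_mx l 0)).
    rewrite -colE mxE => h; apply: le_trans h _.
    rewrite ler_piMr ?exprn_ge0 ?(ltW k0) //; apply: vmax_leP => // i'.
    by rewrite mxE; case: (_ && _); rewrite ?cabs0 // cabs_real normr1.
  have le1 : nu (u j - L) <= k' ^+ (2 ^ j).
    apply: le_trans (hK _ _ entry) _.
    have N2j : (N <= 2 ^ j)%N by apply: leq_trans Nj (ltnW (ltn_expl _ _)).
    have := hN _ N2j; rewrite expr_div_n mulrA ltr_pdivrMr ?exprn_gt0 // mul1r.
    exact: ltW.
  have r0 : 0 <= 1 / 2 ^+ j :> R by rewrite divr_ge0 ?exprn_ge0.
  apply: le_trans (ge0_ler_powR r0 _ _ le1) _; rewrite ?nnegrE ?is_norm_ge0 //.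
    by rewrite exprn_ge0 // ltW.
  by rewrite -powR_mulrn ?(ltW k'0) // -powRrM natrX mul1r mulfV ?expf_neq0 // powRr1 ?(ltW k'0).
apply: (@le_lt_trans _ _ k'%:E); last by rewrite lte_fin.
apply: ge_ereal_inf; exists (ereal_sup
  ((fun j => (nu (u j - L) `^ (1 / 2 ^+ j))%:E) @` [set j | (N <= j)%N]%classic)).
  by exists [set j | (N <= j)%N]%classic => //; exists N.
by apply: ge_ereal_sup => _ [j /= Nj <-]; rewrite lee_fin small.
Qed.

End QuadraticRate.

(** * Spectrum of the closed-loop matrix *)

Section EigenvalueLocalization.
Context {R : realType} {m n : nat}.
Variables (A : 'M[R[i]]_m) (B : 'M[R[i]]_(m, n)).
Variables (C : 'M[R[i]]_(n, m)) (D : 'M[R[i]]_n).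
Variables (w : R) (P : 'M[R[i]]_(m, n)).
Local Notation Q := (coef_mx A B C D).
Hypothesis w01 : 0 <= w <= 1.
Hypothesis diag : forall i, offdiag_sum Q i < omega_re w (Q i i).
Hypothesis ext : extremal_sol A B C D w P.

(** If [x] is an eigenvector, [Q] maps [(x, P x)] to [(l x, - l P x)].
    Gershgorin's theorem thus leaves two cases, and the half plane condition
    excludes the rows of [A], where [- l] would lie in a disc on which
    [omega_re] is positive. *)
Lemma eigenvalue_localization l : eigenvalue (D - C *m P) l ->
  exists i : 'I_n, cabs (D i i - l) <= offdiag_sum Q (lshift m i).
Proof.
move=> el; have l0 := ext.2 l el.
have [x x0 xl] := (eigenvalue_col _ _).1 el.
have v0 : col_mx x (P *m x) != 0.
  by apply: contra x0 => /eqP; rewrite -col_mx0 => /eq_col_mx[-> _].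
have eAP : A *m P = P *m C *m P - P *m D + B.
  have [+ _] := ext.
  by rewrite /riccati_sol => /eqP; rewrite addrAC subr_eq0 => /eqP <-.
have Qv : Q *m col_mx x (P *m x) = col_mx (l *: x) (- (l *: (P *m x))).
  rewrite coef_mx_mul; congr col_mx; first by rewrite -xl mulmxBl mulmxA.
  rewrite scalemxAr -xl !mulmxA eAP mulmxDl mulmxBl mulmxBr.
  by rewrite mulmxBl !mulmxA addrK opprB.
have [|j] := @gershgorin R _ Q (@blockwise m n _ l (- l)) _ v0.
  move=> i; rewrite Qv; move: i; apply: ord_shiftP => i.
    by rewrite !col_mxEu blockwise_l mxE.
  by rewrite !col_mxEd blockwise_r !mxE mulNr.
have [i ->|i ->] := split_ordP j.
  by rewrite blockwise_l coef_mx_ll; exists i.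
rewrite blockwise_r opprK => h.
have := le_lt_trans h (diag (rshift n i)); rewrite ltNge => /negP[].
apply: le_trans (omega_re_le_cabs _ w01).
by rewrite omega_reD lerDl ltW.
Qed.

Lemma closed_loop_spectrum alpha beta c l : 0 < c ->
  shift_dominant A B C D alpha beta c ->
  eigenvalue (D - C *m P) l -> cabs (l - beta) < c * cabs (l + alpha).
Proof.
move=> c0 [domD _] el; have [j] := eigenvalue_localization el.
have := domD j; set q := offdiag_sum _ _; move: (D j j) => d.
have h1 : cabs (l - beta) <= cabs (d - beta) + cabs (d - l).
  by rewrite [l - beta](_ : _ = (d - beta) - (d - l)) ?cabsB //; ring.
have h2 : c * cabs (d + alpha) <= c * cabs (l + alpha) + c * cabs (d - l).
  rewrite -mulrDr ler_wpM2l ?(ltW c0) //.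
  by rewrite [d + alpha](_ : _ = (l + alpha) + (d - l)) ?cabsD //; ring.
move=> dom dl; have := ler_wpM2l (ltW c0) dl.
lra.
Qed.

End EigenvalueLocalization.

(** * Convergence for dominant shifts *)

Section Doubling.
Context {R : realType} {m n : nat}.
Variables (A : 'M[R[i]]_m.+1) (B : 'M[R[i]]_(m.+1, n.+1)).
Variables (C : 'M[R[i]]_(n.+1, m.+1)) (D : 'M[R[i]]_n.+1).
Variables (alpha beta : R[i]) (c : R).
Hypothesis c0 : 0 < c.
Hypothesis ab0 : alpha + beta != 0.
Hypothesis dom : shift_dominant A B C D alpha beta c.

Lemma shifted_closed_loop_unit (L : 'M[R[i]]_n.+1) :
  (forall l, eigenvalue L l -> cabs (l - beta) < c * cabs (l + alpha)) ->
  L + alpha%:M \in unitmx.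
Proof.
move=> loc; apply: unitmx_inj => x Lx; apply/eqP; apply: contraT => x0.
have /loc : eigenvalue L (- alpha).
  apply/eigenvalue_col; exists x => //.
  by move: Lx; rewrite mulmxDl mul_scalar_mx => /eqP; rewrite addr_eq0 scaleNr => /eqP.
by rewrite addNr cabs0 mulr0 ltNge cabs_ge0.
Qed.

(** The matrix [T] is the image of [L] under [l |-> (l - beta) / (l + alpha)]; its
    eigenvalues come from those of [L], and [1] is not a value of this map. *)
Lemma cayley_spectrum (L T : 'M[R[i]]_n.+1) mu :
  (forall l, eigenvalue L l -> cabs (l - beta) < c * cabs (l + alpha)) ->
  (L + alpha%:M) *m T = L - beta%:M ->
  eigenvalue T mu -> cabs mu < c.
Proof.
move=> loc LT /eigenvalue_col[x x0 xmu].
have Lx : (1 - mu) *: (L *m x) = (beta + mu * alpha) *: x.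
  have := congr1 (mulmx^~ x) LT.
  rewrite -mulmxA xmu -scalemxAr mulmxDl mulmxBl !mul_scalar_mx.
  rewrite scalerDr scalerA => h.
  apply/eqP; rewrite scalerBl scale1r scalerDl subr_eq addrC -subr_eq opprD addrA.
  by rewrite -h addrK.
have mu1 : 1 - mu != 0.
  apply/eqP => mu0; have mu1 : mu = 1 by rewrite (subr0_eq mu0).
  move: Lx; rewrite mu1 subrr scale0r mul1r => /esym/eqP.
  by rewrite scaler_eq0 (negPf x0) orbF addrC (negPf ab0).
pose s := (alpha + beta) / (1 - mu).
have s0 : 0 < cabs s by rewrite cabs_gt0 mulf_neq0 ?invr_eq0.
have /loc : eigenvalue L ((beta + mu * alpha) / (1 - mu)).
  apply/eigenvalue_col; exists x => //.
  by rewrite mulrC -scalerA -Lx scalerA mulVf // scale1r.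
have -> : (beta + mu * alpha) / (1 - mu) - beta = mu * s by rewrite /s; field.
have -> : (beta + mu * alpha) / (1 - mu) + alpha = s by rewrite /s; field.
by rewrite cabsM ltr_pM2r.
Qed.

Lemma adda_swap k :
  adda D C B A beta alpha k =
  let S := adda A B C D alpha beta k in AddaState (Fk S) (Ek S) (Hk S) (Gk S).
Proof.
elim: k => [|k IHk]; first exact: adda_init_swap dom.
rewrite /adda !iterS -/(adda D C B A beta alpha k) IHk /=.
by rewrite -/(adda A B C D alpha beta k); case: (adda _ _ _ _ _ _ k).
Qed.

Lemma adda_well_defined_of_dominance : adda_well_defined A B C D alpha beta.
Proof.
have [k [k0 k1 con]] := contractive_init c0 dom.
have k01 : 0 <= k < 1 by rewrite (ltW k0).
split; first exact: A_shift_unit dom.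
- exact: D_shift_unit dom.
- exact: W_mx_unit dom.
- exact: V_mx_unit dom.
- move=> j; apply: (@contractive_unit _ _ _ k (c ^+ (2 ^ j))) => //.
    by rewrite exprn_gt0.
  exact: contractive_iter.
Qed.

Lemma doubling_cvg (P : 'M[R[i]]_(m.+1, n.+1)) :
  riccati_sol A B C D P ->
  (forall l, eigenvalue (D - C *m P) l -> cabs (l - beta) < c * cabs (l + alpha)) ->
  quadratic_cvg (fun k => Hk (adda A B C D alpha beta k)) P.
Proof.
move=> ric loc; have [k [k0 k1 con]] := contractive_init c0 dom.
pose T := invmx (D - C *m P + alpha%:M) *m (D - C *m P - beta%:M).
have LT : (D - C *m P + alpha%:M) *m T = D - C *m P - beta%:M.
  by rewrite mulKVmx // shifted_closed_loop_unit.
have itw := intertwines_init c0 dom ric LT.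
have bnd := power_bounded c0 (fun mu => cayley_spectrum loc LT).
apply: (@quadratic_cvg_sup _ _ _ k); first by rewrite k0.
exact: doubling_error c0 k0 k1 con itw bnd.
Qed.

End Doubling.

Lemma offdiag_sum_lt_omega_re (R : realType) (w : R) N (Q : 'M[R[i]]_N) i :
  mx_pos (comparison_mx w Q *m (const_mx 1 : 'cV_N)) ->
  offdiag_sum Q i < omega_re w (Q i i).
Proof.
move=> /(_ i 0); rewrite mxE (bigD1 i) //= !mxE eqxx mulr1.
under eq_bigr => j ji do rewrite !mxE eq_sym (negPf ji) mulr1.
by rewrite sumrN subr_gt0.
Qed.

(** Replacing [c] by [1 / c] and [t] by [c t] turns the formula for the rows of
    [D] into [c] times the formula for the rows of [A], so [row_gap] serves both
    blocks. *)
Lemma shift_dominant_of_parameters (R : realType) (m n : nat) (w : R)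
    (A : 'M[R[i]]_m.+1) (B : 'M[R[i]]_(m.+1, n.+1))
    (C : 'M[R[i]]_(n.+1, m.+1)) (D : 'M[R[i]]_n.+1) (t c : R) :
  let Q := coef_mx A B C D in
  0 <= w <= 1 -> (forall i, offdiag_sum Q i < omega_re w (Q i i)) -> 0 < c ->
  Order.max (eta1 w Q c) (eta2 w Q c) < t ->
  0 < t /\ shift_dominant A B C D (t%:C * z_bot w) ((c * t)%:C * z_bot w) c.
Proof.
move=> Q w01 diag c0; rewrite gt_max => /andP[t1 t2].
have rl i : r_ w Q c (lshift m.+1 i) < t.
  apply: le_lt_trans t1.
  exact: (le_bigmax _ (fun i => r_ w Q c (lshift m.+1 i))).
have rr i : r_ w Q c (rshift n.+1 i) < t.
  apply: le_lt_trans t2.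
  exact: (le_bigmax _ (fun i => r_ w Q c (rshift n.+1 i))).
have gapD i : 0 < t /\ (1 + c) * offdiag_sum Q (lshift m.+1 i)
    + cabs (D i i - (c * t)%:C * z_bot w) < c * cabs (D i i + t%:C * z_bot w).
  have := rl i; rewrite /r_ (unsplitK (inl i)) => h.
  have := row_gap w01 (offdiag_sum_ge0 Q _) (diag _) c0 h.
  by rewrite coef_mx_ll.
have t0 : 0 < t := (gapD ord0).1.
split=> //; split=> [i|i]; first exact: (gapD i).2.
have cV0 : 0 < c^-1 by rewrite invr_gt0.
have cN0 : c != 0 by rewrite gt_eqF.
have vp0 : 0 < varpi w.
  by rewrite -cabs_z_bot_sqr exprn_gt0 //; case/andP: (cabs_z_bot w01).
have := rr i; rewrite /r_ (unsplitK (inr i)) /=.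
set p := p_ _ _ _ => h.
have discrE : (c^-1 - 1) ^+ 2 * p ^+ 2 +
     4 * c^-1 * (p ^+ 2 - s_ w Q (rshift n.+1 i) ^+ 2) =
    (c ^-1) ^+ 2 * r_discr w Q c (rshift n.+1 i).
  by rewrite /r_discr -/p; field.
have h' : (- (c^-1 - 1) * p + Num.sqrt ((c^-1 - 1) ^+ 2 * p ^+ 2 +
      4 * c^-1 * (p ^+ 2 - s_ w Q (rshift n.+1 i) ^+ 2)))
    / (2 * c^-1 * varpi w) < c * t.
  rewrite discrE sqrtrM ?sqr_ge0 // sqrtr_sqr gtr0_norm //.
  rewrite [ltLHS](_ : _ = c * (((c - 1) * p + Num.sqrt (r_discr w Q c (rshift n.+1 i)))
    / (2 * c * varpi w))); first by rewrite ltr_pM2l.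
  by field; rewrite cN0 gt_eqF.
have [_] := row_gap w01 (offdiag_sum_ge0 Q _) (diag _) cV0 h'.
rewrite coef_mx_rr mulrA mulVf // mul1r -(ltr_pM2l c0) mulrDr !mulrA mulrDr mulr1.
by rewrite mulfV // mul1r (addrC c).
Qed.

Theorem theorem6p9 (R : realType) (m n : nat) (w : R)
    (A : 'M[R[i]]_m.+1) (B : 'M[R[i]]_(m.+1, n.+1))
    (C : 'M[R[i]]_(n.+1, m.+1)) (D : 'M[R[i]]_n.+1)
    (Phi : 'M[R[i]]_(m.+1, n.+1)) (Psi : 'M[R[i]]_(n.+1, m.+1))
    (t gamma c : R) :
  0 <= w <= 1 ->
  class_H A B C D w ->
  mx_pos (comparison_mx w (coef_mx A B C D) *m (const_mx 1 : 'cV[R]_(n.+1 + m.+1))) ->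
  extremal_sol A B C D w Phi ->
  extremal_sol D C B A w Psi ->
  0 < c ->
  gamma = c * t ->
  Order.max (eta1 w (coef_mx A B C D) c) (eta2 w (coef_mx A B C D) c) < t ->
  let alpha := t%:C * z_bot w in
  let beta := gamma%:C * z_bot w in
  let S := adda A B C D alpha beta in
  [/\ adda_well_defined A B C D alpha beta,
      quadratic_cvg (fun k => Hk (S k)) Phi &
      quadratic_cvg (fun k => Gk (S k)) Psi].
Proof.
move=> w01 _ Q1 extPhi extPsi c0 -> teta alpha beta S.
pose Q := coef_mx A B C D.
have diag i : offdiag_sum Q i < omega_re w (Q i i).
  exact: offdiag_sum_lt_omega_re.
have diag' i : offdiag_sum (coef_mx D C B A) i < omega_re w (coef_mx D C B A i i).
  move: i; apply: ord_shiftP => i.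
    rewrite coef_mx_ll offdiag_coef_l -(offdiag_coef_r A B C D).
    by have := diag (rshift n.+1 i); rewrite coef_mx_rr.
  rewrite coef_mx_rr offdiag_coef_r -(offdiag_coef_l A B C D).
  by have := diag (lshift m.+1 i); rewrite coef_mx_ll.
have [t0 dom] := shift_dominant_of_parameters w01 diag c0 teta.
have z0 : z_bot w != 0 by rewrite -cabs_gt0; case/andP: (cabs_z_bot w01).
have ab0 : alpha + beta != 0.
  rewrite -mulrDl -rmorphD mulf_neq0 //.
  by rewrite (inj_eq (@complexI R)) gt_eqF ?addr_gt0 ?mulr_gt0.
have dom' := shift_dominant_swap c0 dom.
have cV0 : 0 < c^-1 by rewrite invr_gt0.
split; first exact: adda_well_defined_of_dominance dom.
- apply: (doubling_cvg c0 ab0 dom extPhi.1) => l.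
  exact: (closed_loop_spectrum w01 diag extPhi c0 dom).
- have ba0 : beta + alpha != 0 by rewrite addrC.
  have cvg : quadratic_cvg (fun k => Hk (adda D C B A beta alpha k)) Psi.
    apply: (doubling_cvg cV0 ba0 dom' extPsi.1) => l.
    exact: (closed_loop_spectrum w01 diag' extPsi cV0 dom').
  have swap k : Hk (adda D C B A beta alpha k) = Gk (S k).
    by rewrite (adda_swap c0 dom).
  by move=> nu /cvg; under eq_fun do rewrite swap.
Qed.
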